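(* Fix $0<a<1$ and let $L=L_N=N^a$ (see the convention on $L$ in the context). Let $\nu>0$ and $\epsilon>0$. There is a $p(\nu)\in(0,1/2)$, depending only on $\nu$, such that for every $p\le p(\nu)$ and all initial conditions $G(0)\in\mathcal G(p,N,L)$, the efficient discrete-time rewire-to-random evolving voter model with parameter $\nu$ started from $G(0)$ satisfies, with probability tending to $1$ as $N\to\infty$ (uniformly over $G(0)\in\mathcal G(p,N,L)$): $\tau<7NL$ and the fraction of vertices in state $1$ at time $\tau$ lies in $(p-\epsilon,p+\epsilon)$, where $\tau$ is the first time (number of updates) at which there are no discordant edges.
   Context: Convention on $L$: $L=L_N$ are positive integers with $NL$ even and $L_N/N^a\to 1$ as $N\to\infty$, where $0<a<1$ is fixed. $\mathcal G(p,N,L)$ is the set of simple graphs with vertex set $V=\{1,\dots,N\}$, vertices labeled with states $0$ and $1$, such that the number of vertices in state $1$ is $pN$ and the number of edges is $NL/2$. ($p\ge 0$ is fixed and $N\to\infty$ along values with $pN$ an integer.) Efficient discrete-time rewire-to-random evolving voter model with parameter $\nu>0$: the state of the process is a simple graph on $V$ together with an opinion (state) in $\{0,1\}$ at each vertex. An edge is discordant if its two endpoints have different states. At each step (update), as long as there is a discordant edge, a discordant edge is picked uniformly at random and given one of its two orientations $(v,u)$, each with probability $1/2$ ($v$ is the root of the update). Then, independently, with probability $\nu/L$ a voting (relabeling) event occurs: $v$ adopts the state of $u$. Otherwise, with probability $1-\nu/L$, a rewiring event occurs: the edge between $v$ and $u$ is deleted and replaced by an edge from $v$ to a vertex $z$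 chosen uniformly at random from all vertices that are different from $v$ and were not neighbors of $v$ (if there is no such vertex, the graph is left unchanged). Once there are no discordant edges the process stays constant. *)

(* Defs.v *)
(* MathComp-Analysis *)
From HB Require Import structures.
From mathcomp Require Import all_boot all_order all_algebra.
From mathcomp Require Import all_classical all_reals all_analysis.

Set Implicit Arguments.
Unset Strict Implicit.
Unset Printing Implicit Defensive.

Import Order.TTheory GRing.Theory Num.Theory.
Import numFieldNormedType.Exports.

Local Open Scope ring_scope.

(* A configuration is an edge set on 'I_N together with the states of the
   vertices, [true] standing for state 1.  Simplicity of the graph is the
   separate predicate [simple_graph]; it is preserved by the dynamics. *)
Definition config (N : nat) : finType :=
  ({set {set 'I_N}} * {ffun 'I_N -> bool})%type.

Definition edges (N : nat) (x : config N) : {set {set 'I_N}} := x.1.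

Definition state (N : nat) (x : config N) : {ffun 'I_N -> bool} := x.2.

Definition simple_graph (N : nat) (E : {set {set 'I_N}}) : bool :=
  [forall e in E, #|e| == 2%N].

Definition ones (N : nat) (x : config N) : {set 'I_N} :=
  [set v | state x v].

(* The set G(p, N, L); it is empty when p * N is not a natural number. *)
Definition initial_config (R : realType) (p : R) (N L : nat) (x : config N) :
    Prop :=
  [/\ simple_graph (edges x),
      #|ones x|%:R = p * N%:R
    & #|edges x| = (N * L)./2].

Definition discordant (N : nat) (x : config N) : {set {set 'I_N}} :=
  [set e in edges x |
    [exists v in e, exists u in e, state x v != state x u]].

Definition vote (N : nat) (x : config N) (v u : 'I_N) : config N :=
  (edges x, [ffun w => if w == v then state x u else state x w]).

Definition rewire (N : nat) (x : config N) (v u z : 'I_N) : config N :=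
  ([set v; z] |: (edges x :\ [set v; u]), state x).

(* Neighbours are taken before the edge {v, u} is deleted, so u is excluded. *)
Definition rewire_targets (N : nat) (x : config N) (v : 'I_N) : {set 'I_N} :=
  [set z | (z != v) && ([set v; z] \notin edges x)].

Definition rewire_prob (R : realType) (N : nat) (x : config N) (v u : 'I_N)
    (y : config N) : R :=
  let Z := rewire_targets x v in
  if Z == finset.set0 then (y == x)%:R
  else \sum_(z in Z) #|Z|%:R^-1 * (y == rewire x v u z)%:R.

(* [step_prob nu L x y] is the probability that one update leads from x to y:
   an edge e uniform among the discordant ones, an orientation (o.1, o.2) of e
   with root o.1, then a vote with probability nu / L and a rewiring
   otherwise. *)
Definition step_prob (R : realType) (nu : R) (L N : nat) (x y : config N) : R :=
  let D := discordant x in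
  if D == finset.set0 then (y == x)%:R
  else \sum_(e in D) #|D|%:R^-1 *
         \sum_(o : 'I_N * 'I_N | [set o.1; o.2] == e) 2^-1 *
           (nu / L%:R * (y == vote x o.1 o.2)%:R +
            (1 - nu / L%:R) * rewire_prob R x o.1 o.2 y).

(* X is a discrete-time Markov chain on the finite set S, started from s0,
   with one-step transition probabilities Q. *)
Definition markov_chain (R : realType) (d : measure_display)
    (T : measurableType d) (P : probability T R) (S : finType)
    (Q : S -> S -> R) (s0 : S) (X : nat -> T -> S) : Prop :=
  (forall n s, measurable [set t | X n t = s]%classic) /\
  (forall n (w : nat -> S),
    P [set t | forall i, (i <= n)%N -> X i t = w i]%classic =
    ((w 0%N == s0)%:R * \prod_(i < n) Q (w i) (w i.+1))%:E).

Definition evolving_voter_model (R : realType) (d : measure_display)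
    (T : measurableType d) (P : probability T R) (nu : R) (L N : nat)
    (G0 : config N) (X : nat -> T -> config N) : Prop :=
  markov_chain P (step_prob nu L (N := N)) G0 X.

(* [is_tau x n] says that tau = n along the trajectory x; tau is infinite when
   there is no such n. *)
Definition is_tau (N : nat) (x : nat -> config N) (n : nat) : Prop :=
  discordant (x n) = finset.set0 /\
  (forall m, (m < n)%N -> discordant (x m) <> finset.set0).

Definition fraction_ones (R : realType) (N : nat) (x : config N) : R :=
  #|ones x|%:R / N%:R.

(* Main.v *)
Require Import Defs.
From HB Require Import structures.
From mathcomp Require Import all_boot all_order all_algebra.
From mathcomp Require Import all_classical all_reals all_analysis.
From mathcomp Require Import ring lra zify.

Set Implicit Arguments.
Unset Strict Implicit.
Unset Printing Implicit Defensive.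

Import Order.TTheory GRing.Theory Num.Theory.
Import numFieldNormedType.Exports.

Local Open Scope ring_scope.

(* Write q = nu / L, let d_v be the degree of v, and consider

     V = sum_v (d_v - K L)^+ + H_1 + s H_2
         + beta L * sum_(u in state 1) (1 - (1 - q)^(d_u)),   s = beta nu.

   - A discordant edge rewired at its root takes its other end away to an almost
     uniform vertex. Since the degrees add up to N L, few vertices have degree
     above K L, so the first term has drift about -1/2 as long as the endpoints
     in state 0 of the discordant edges mostly have degree above K L.
   - In the last sum, voting and the loss of edges cancel exactly thanks to the
     base 1 - q: an edge from v (state 0) to u (state 1) contributes just
     -(q / 2) (1 - q)^(d_v). This is a drift of -1/2 when d_v <= K L, for
     s = exp (2 nu K).
   - Roots adjacent to almost all vertices do not rewire to an almost uniform
     vertex. The corrections H_i penalize degrees close to N and pairs of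
     nonadjacent vertices of such degrees, and the drift they bring pays for
     those roots.

   Hence V has drift at most -5/16 as long as the vertices in state 1 are a small
   enough fraction, and V <= (25/16) N L at time 0. As V is nonnegative, the
   exponential supermartingale exp (lambda (V + t/4)), with lambda of order 1/L,
   rules out survival up to time 7 N L. The number of vertices in state 1 is a
   martingale with variance q per step, so it moves by o(N) in that time. *)

(** * Degrees and rewiring *)

Section Graph.
Variable N : nat.
Implicit Types (E : {set {set 'I_N}}) (x : config N) (a b v u r o z w : 'I_N).

Definition adjacent E a b : bool := [set a; b] \in E.

Definition nbrs E v : {set 'I_N} := [set z | adjacent E v z].

Definition deg E v : nat := #|nbrs E v|.

Lemma adjacentC E a b : adjacent E a b = adjacent E b a.
Proof. by rewrite /adjacent finset.setUC. Qed.

Lemma adjacent_neq E a b : simple_graph E -> adjacent E a b -> a != b.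
Proof.
move=> /forallP/(_ [set a; b])/implyP sE ab.
by move: (sE ab); rewrite cards2; case: (a == b).
Qed.

Lemma adjacentxx E a : simple_graph E -> adjacent E a a = false.
Proof.
by move=> sE; apply/negP => /(adjacent_neq sE); rewrite eqxx.
Qed.

Lemma eq_set2 a b u v :
  ([set a; b] == [set u; v]) = (a == u) && (b == v) || (a == v) && (b == u).
Proof.
apply/eqP/idP => [e|/orP[]/andP[/eqP-> /eqP->]//]; last first.
  by rewrite finset.setUC.
have : a \in [set u; v] by rewrite -e !inE eqxx.
have : b \in [set u; v] by rewrite -e !inE eqxx orbT.
have : u \in [set a; b] by rewrite e !inE eqxx.
have : v \in [set a; b] by rewrite e !inE eqxx orbT.
rewrite !inE.
by do 4!case/orP => /eqP ?; subst; rewrite ?eqxx ?orbT.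
Qed.

Lemma sum_orientations (R : nmodType) (F : 'I_N * 'I_N -> R) a b : a != b ->
  \sum_(d | [set d.1; d.2] == [set a; b]) F d = F (a, b) + F (b, a).
Proof.
move=> ab; rewrite (eq_bigl (predU1 (a, b) (pred1 (b, a)))); last first.
  by case=> u v /=; rewrite eq_set2 !xpair_eqE.
rewrite (bigD1 (a, b)) /=; last by rewrite eqxx.
congr (_ + _); rewrite (eq_bigl (pred1 (b, a))) ?big_pred1_eq// => -[u v] /=.
rewrite !xpair_eqE; case: (eqVneq u b) => [->|]/=; last first.
  by move=> _; rewrite orbF andbN.
by rewrite eq_sym (negbTE ab)/= andbT.
Qed.

(** Double counting: every edge of a simple graph has exactly two orientations. *)
Lemma card_adjacent E : simple_graph E ->
  (\sum_(d : 'I_N * 'I_N | adjacent E d.1 d.2) 1 = 2 * #|E|)%N.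
Proof.
move=> sE.
rewrite (partition_big (fun d : 'I_N * 'I_N => [set d.1; d.2]) (mem E))//=.
rewrite mulnC -sum_nat_const; apply: eq_bigr => e eE.
have /cards2P[a [b [ab e_ab]]] : #|e| == 2%N.
  by move/forallP: sE => /(_ e)/implyP; apply.
rewrite (eq_bigl (fun d : 'I_N * 'I_N => [set d.1; d.2] == [set a; b])).
  by rewrite (sum_orientations (fun=> 1%N)).
move=> d; rewrite /adjacent e_ab; case: eqP => [->|]; last by rewrite andbF.
by rewrite -e_ab eE.
Qed.

Lemma sum_deg E : simple_graph E -> (\sum_v deg E v = 2 * #|E|)%N.
Proof.
move=> sE; rewrite -card_adjacent// (eq_bigr (fun v =>
  \sum_(z | adjacent E v z) 1)%N) => [|v _]; last first.
  by rewrite /deg -sum1_card; apply: eq_bigl => z; rewrite inE.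
by rewrite pair_big_dep.
Qed.

(** The vertices split into the targets, the neighbours of [v] and [v] itself, whence the
    successor. *)
Lemma card_rewire_targets x v : simple_graph (edges x) ->
  (#|rewire_targets x v| + deg (edges x) v).+1 = N.
Proof.
move=> sE; rewrite -[RHS](card_ord N) -(cardsC (rewire_targets x v)).
rewrite -addnS; congr (_ + _)%N.
have -> : ~: rewire_targets x v = v |: nbrs (edges x) v.
  by apply/setP => z; rewrite !inE negb_and !negbK.
by rewrite cardsU1 inE adjacentxx// add1n.
Qed.

(** * Effect of a rewiring on adjacency and degrees *)

Section Rewire.
Variables (x : config N) (r o z : 'I_N).
Hypotheses (sE : simple_graph (edges x)) (ro : adjacent (edges x) r o).
Hypothesis rz : z \in rewire_targets x r.

Let E := edges x.
Let E' := edges (rewire x r o z).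

Let zr : z != r. Proof. by move: rz; rewrite inE => /andP[]. Qed.
Let nrz : adjacent E r z = false.
Proof. by move: rz; rewrite inE => /andP[_ /negbTE]. Qed.
Let r_neq_o : r != o. Proof. exact: adjacent_neq sE ro. Qed.

Lemma rewire_oz : o != z.
Proof. by apply/eqP => oz; move: nrz; rewrite -oz /E ro. Qed.

Lemma adjacent_rewire a b : adjacent E' a b =
  ([set a; b] == [set r; z]) || ([set a; b] != [set r; o]) && adjacent E a b.
Proof. by rewrite /adjacent !inE. Qed.

Lemma simple_rewire : simple_graph E'.
Proof.
apply/forallP => e; apply/implyP; rewrite !inE => /orP[/eqP->|/andP[_ eE]].
  by rewrite cards2 (eq_sym r z) zr.
by move/forallP: sE => /(_ e)/implyP; apply.
Qed.

Lemma card_rewire : #|E'| = #|E|.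
Proof.
have := nrz; rewrite /adjacent /E => h; rewrite cardsU1 !inE h andbF add1n.
by rewrite (cardsD1 [set r; o] E) -/(adjacent E r o) ro add1n.
Qed.

Lemma nbrs_rewire_root : nbrs E' r = z |: (nbrs E r :\ o).
Proof.
apply/setP => w; rewrite !inE adjacent_rewire !eq_set2 !eqxx/= !(eq_sym r).
by rewrite (negbTE zr) (eq_sym o) (negbTE r_neq_o) !orbF.
Qed.

Lemma deg_rewire_root : deg E' r = deg E r.
Proof.
rewrite /deg nbrs_rewire_root cardsU1 !inE nrz andbF add1n.
by rewrite [in RHS](cardsD1 o) inE ro.
Qed.

Lemma deg_rewire_lost : deg E o = (deg E' o).+1.
Proof.
rewrite /deg (cardsD1 r) inE adjacentC ro add1n; congr _.+1.
congr #|pred_of_set _|; apply/setP => w.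
rewrite !inE adjacent_rewire !eq_set2 eqxx/= (eq_sym o r) (negbTE r_neq_o)/=.
by rewrite (negbTE rewire_oz).
Qed.

Lemma deg_rewire_gained : deg E' z = (deg E z).+1.
Proof.
rewrite /deg (cardsD1 r) inE adjacent_rewire eq_set2 !eqxx orbT/= add1n.
congr _.+1; congr #|pred_of_set _|; apply/setP => w.
rewrite !inE adjacent_rewire !eq_set2 eqxx/= (negbTE zr)/=.
rewrite (eq_sym z o) (negbTE rewire_oz)/=.
case: (eqVneq w r) => //= ->.
by rewrite adjacentC nrz.
Qed.

Lemma deg_rewire_other w : w != o -> w != z -> deg E' w = deg E w.
Proof.
move=> wo wz; case: (eqVneq w r) => [->|wr]; first exact: deg_rewire_root.
congr #|pred_of_set _|; apply/setP => b.
by rewrite !inE adjacent_rewire !eq_set2 (negbTE wo) (negbTE wz) (negbTE wr).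
Qed.

(** Reversibility: the same root can move its edge from [z] back to [o]. An upper bound on an
    increment, valid for all rewirings, is thereby two-sided. *)
Lemma rewireK : rewire (rewire x r o z) r z o = x.
Proof.
rewrite [RHS]surjective_pairing; congr (_, _); apply/setP => e.
have := nrz; rewrite /E /adjacent => nrz'; rewrite !inE.
case: (eqVneq e [set r; o]) => [->|_] /=; first exact/esym/ro.
by case: (eqVneq e [set r; z]) => [->|_] //=; rewrite -nrz'.
Qed.

Lemma adjacent_rewire_gained : adjacent E' r z.
Proof. by rewrite adjacent_rewire eqxx. Qed.

Lemma rewire_targets_lost : o \in rewire_targets (rewire x r o z) r.
Proof.
rewrite inE eq_sym r_neq_o/= -/(adjacent E' r o) adjacent_rewire eqxx/= orbF.
by rewrite eq_set2 eqxx/= (negbTE rewire_oz) (eq_sym r) (negbTE zr).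
Qed.

End Rewire.
End Graph.

(** * The transition operator *)

Section StepMean.
Variables (R : realType) (nu : R) (L N : nat).
Implicit Types (x y : config N) (f g : config N -> R) (v u r o z : 'I_N).
Local Notation q := (nu / L%:R).

Definition step_mean f x : R := \sum_y step_prob nu L x y * f y.

Definition rewire_mean f x r o : R :=
  \sum_y rewire_prob R x r o y * f y.

Definition root_mean f x r o : R :=
  q * f (vote x r o) + (1 - q) * rewire_mean f x r o.

(* Discordant edges, listed with the endpoint in state 0 first. *)
Definition arcs x : {set 'I_N * 'I_N} :=
  [set d | adjacent (edges x) d.1 d.2 && (~~ state x d.1 && state x d.2)].

Lemma sum_pointmass f x : \sum_y (y == x)%:R * f y = f x.
Proof.
rewrite (bigD1 x)//= eqxx mul1r big1 ?addr0// => y /negbTE->.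
by rewrite mul0r.
Qed.

Lemma mem_discordant x v u :
  ([set v; u] \in discordant x) =
  adjacent (edges x) v u && (state x v != state x u).
Proof.
rewrite inE -/(adjacent (edges x) v u); congr andb.
apply/existsP/idP => [[a /andP[av /existsP[b /andP[bv]]]]|vu].
  by move: av bv; rewrite !inE => /orP[]/eqP-> /orP[]/eqP->;
    rewrite ?eqxx// eq_sym.
exists v; rewrite !inE eqxx/=; apply/existsP; exists u.
by rewrite !inE eqxx orbT.
Qed.

(** A discordant edge has exactly one orientation starting in state 0, and its other orientation is
    the swapped pair. *)
Lemma sum_discordant (F : 'I_N * 'I_N -> R) x :
  \sum_(e in discordant x) \sum_(d | [set d.1; d.2] == e) F d =
  \sum_(d in arcs x) (F d + F (d.2, d.1)).
Proof.
(* Both sides are compared with the sum over all ordered discordant pairs. *)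
transitivity (\sum_(d | adjacent (edges x) d.1 d.2 &&
                        (state x d.1 != state x d.2)) F d).
  rewrite [RHS](partition_big (fun d : 'I_N * 'I_N => [set d.1; d.2])
    (mem (discordant x))) => [|d]/=; last by rewrite -mem_discordant.
  apply: eq_bigr => e eD; apply: eq_bigl => d; rewrite -mem_discordant.
  by case: eqP => [->|]; rewrite ?andbF// eD.
rewrite big_split/= (bigID (fun d : 'I_N * 'I_N => ~~ state x d.1))/=.
congr (_ + _).
  by apply: eq_bigl => d; rewrite inE; case: adjacent; case: (state x d.1);
    case: (state x d.2).
rewrite [RHS](reindex_inj (h := fun d : 'I_N * 'I_N => (d.2, d.1)))/=.
  apply: eq_big => [d|[]//]; rewrite inE/= adjacentC.
  by case: adjacent; case: (state x d.1); case: (state x d.2).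
by case=> a b [a' b'] [-> ->].
Qed.

Lemma card_arcs x : simple_graph (edges x) -> #|arcs x| = #|discordant x|.
Proof.
move=> sE; apply/eqP; rewrite -(eqr_nat R).
have /eqP := sum_discordant (fun=> 1) x.
rewrite (eq_bigr (fun=> 2 : R)) => [|e]; last first.
  rewrite inE => /andP[eE _].
  have /cards2P[a [b [ab ->]]] : #|e| == 2%N.
    by move/forallP: sE => /(_ e)/implyP; apply.
  exact: (sum_orientations (fun=> 1)).
rewrite !sumr_const -!(mulr_natr 2) (inj_eq (mulfI _)) ?pnatr_eq0// eq_sym.
by [].
Qed.

Lemma rewire_meanE f x r o : rewire_mean f x r o =
  if rewire_targets x r == finset.set0 then f x else
  \sum_(z in rewire_targets x r)
    #|rewire_targets x r|%:R^-1 * f (rewire x r o z).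
Proof.
rewrite /rewire_mean /rewire_prob; case: ifP => _; first exact: sum_pointmass.
under eq_bigr do rewrite big_distrl.
rewrite exchange_big; apply: eq_bigr => z _ /=.
under eq_bigr do rewrite -mulrA.
by rewrite -big_distrr/= sum_pointmass.
Qed.

(** The two possible roots of an edge stand side by side, so that a loss at one root can be paid for
    by a gain at the other. *)
Lemma step_meanE f x : simple_graph (edges x) ->
  discordant x != finset.set0 ->
  step_mean f x = #|arcs x|%:R^-1 *
    \sum_(d in arcs x) (root_mean f x d.1 d.2 + root_mean f x d.2 d.1) / 2.
Proof.
move=> sE D0; rewrite /step_mean /step_prob (negbTE D0) card_arcs//.
rewrite big_distrr/= (eq_bigr (fun d => #|discordant x|%:R^-1 *
  (root_mean f x d.1 d.2 / 2) + #|discordant x|%:R^-1 *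
  (root_mean f x d.2 d.1 / 2))); last by move=> d _; ring.
rewrite -(sum_discordant
  (fun d => #|discordant x|%:R^-1 * (root_mean f x d.1 d.2 / 2)))/=.
under eq_bigr do rewrite big_distrl.
rewrite exchange_big; apply: eq_bigr => e _ /=.
under eq_bigr do rewrite big_distrr big_distrl.
rewrite exchange_big; apply: eq_bigr => d _ /=.
rewrite /root_mean /rewire_mean -(sum_pointmass f (vote _ _ _)).
rewrite !big_distrr -big_split/= big_distrl big_distrr/=.
by apply: eq_bigr => y _; ring.
Qed.

End StepMean.

(** * One-step averages and the number of vertices in state 1 *)

Section OneStep.
Variables (R : realType) (nu : R) (L N : nat).
Implicit Types (x y : config N) (f g : config N -> R) (v u r o z : 'I_N).
Local Notation q := (nu / L%:R).
Local Notation step_mean := (step_mean nu L).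

Definition discordant_pair x v u : bool :=
  adjacent (edges x) v u && (state x v != state x u).

Lemma arcs_discordant x d : d \in arcs x ->
  discordant_pair x d.1 d.2 && discordant_pair x d.2 d.1.
Proof.
rewrite inE /discordant_pair (adjacentC _ d.2) => /and3P[-> /negbTE-> ->].
by [].
Qed.

(** Without targets this is the empty sum 0, the right value for increments since the graph is then
    left unchanged. *)
Definition target_mean x r (g : 'I_N -> R) : R :=
  \sum_(z in rewire_targets x r) #|rewire_targets x r|%:R^-1 * g z.

Lemma le_target_mean x r (g h : 'I_N -> R) :
  (forall z, z \in rewire_targets x r -> g z <= h z) ->
  target_mean x r g <= target_mean x r h.
Proof.
by move=> gh; apply: ler_sum => z zZ; rewrite ler_wpM2l ?invr_ge0 ?gh.
Qed.

Lemma target_meanD x r (g h : 'I_N -> R) :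
  target_mean x r (fun z => g z + h z) = target_mean x r g + target_mean x r h.
Proof.
by rewrite /target_mean -big_split; apply: eq_bigr => i _; rewrite mulrDr.
Qed.

Lemma target_meanZ x r c (g : 'I_N -> R) :
  target_mean x r (fun z => c * g z) = c * target_mean x r g.
Proof.
by rewrite /target_mean big_distrr; apply: eq_bigr => i _; rewrite mulrCA.
Qed.

Lemma target_mean_cst x r c : rewire_targets x r != finset.set0 ->
  target_mean x r (fun=> c) = c.
Proof.
move=> Z0; rewrite /target_mean sumr_const -mulrnAl.
rewrite -[_^-1 *+ _]mulr_natr mulVf ?mul1r//.
by rewrite pnatr_eq0 cards_eq0.
Qed.

Lemma target_mean_cst_le x r c : 0 <= c -> target_mean x r (fun=> c) <= c.
Proof.
move=> c0; case: (eqVneq (rewire_targets x r) finset.set0) => Z0.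
  by rewrite /target_mean Z0 big_set0.
by rewrite target_mean_cst.
Qed.

Lemma rewire_mean_diff f x r o :
  rewire_mean (fun y => f y - f x) x r o =
  target_mean x r (fun z => f (rewire x r o z) - f x).
Proof.
rewrite rewire_meanE; case: eqP => [Z0|//].
by rewrite /target_mean Z0 big_set0 subrr.
Qed.

Lemma step_meanD f g x :
  step_mean (fun y => f y + g y) x = step_mean f x + step_mean g x.
Proof. by rewrite /step_mean -big_split; apply: eq_bigr => i _; rewrite mulrDr. Qed.

Lemma step_meanZ c f x : step_mean (fun y => c * f y) x = c * step_mean f x.
Proof. by rewrite /step_mean big_distrr; apply: eq_bigr => i _; rewrite mulrCA. Qed.

Section Discordant.
Variable x : config N.
Hypotheses (sE : simple_graph (edges x)) (D0 : discordant x != finset.set0).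
Hypothesis q01 : 0 <= q <= 1.

Lemma card_arcs_gt0 : (0 < #|arcs x|)%N.
Proof. by rewrite card_arcs// card_gt0. Qed.

(** The comparison is asked for only at configurations reachable in one update, so that invariants
    of the dynamics can be used to prove it. The configuration [x] is among them because a root
    without targets changes nothing. *)
Lemma le_step_mean f g :
  (forall v u, discordant_pair x v u -> f (vote x v u) <= g (vote x v u)) ->
  (forall r o z, discordant_pair x r o -> z \in rewire_targets x r ->
    f (rewire x r o z) <= g (rewire x r o z)) ->
  f x <= g x -> step_mean f x <= step_mean g x.
Proof.
move=> fgv fgr fgx; rewrite !step_meanE// ler_wpM2l ?invr_ge0//.
have H v u : discordant_pair x v u ->
    root_mean nu L f x v u <= root_mean nu L g x v u.
  move=> vu; case/andP: q01 => q0 q1; apply: lerD; first by rewrite ler_wpM2l ?fgv.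
  rewrite ler_wpM2l ?subr_ge0// !rewire_meanE; case: ifP => // _.
  by apply: le_target_mean => z; apply: fgr.
apply: ler_sum => d /arcs_discordant/andP[d1 d2].
by rewrite ler_wpM2r ?invr_ge0//; apply: lerD; apply: H.
Qed.

Lemma step_mean_cst c : step_mean (fun=> c) x = c.
Proof.
have H v u : root_mean nu L (fun=> c) x v u = c.
  rewrite /root_mean rewire_meanE; case: (eqVneq _ finset.set0) => Z0.
    by ring.
  by rewrite -/(target_mean _ _ _) target_mean_cst//; ring.
rewrite step_meanE// (eq_bigr (fun=> c)) => [|d _]; last by rewrite !H; lra.
by rewrite sumr_const -[X in _ * X]mulr_natl mulrA mulVf ?mul1r//
    pnatr_eq0 -lt0n card_arcs_gt0.
Qed.

Lemma step_mean_arcs_le f (c : 'I_N * 'I_N -> R) :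
  (forall d, d \in arcs x ->
    root_mean nu L f x d.1 d.2 + root_mean nu L f x d.2 d.1 <= 2 * c d) ->
  step_mean f x <= #|arcs x|%:R^-1 * \sum_(d in arcs x) c d.
Proof.
move=> fc; rewrite step_meanE// ler_wpM2l ?invr_ge0//.
by apply: ler_sum => d dx; rewrite ler_pdivrMr// mulrC fc.
Qed.

Lemma ones_vote_gain v u : ~~ state x v -> state x u ->
  #|ones (vote x v u)| = #|ones x|.+1.
Proof.
move=> sv su; rewrite (cardsD1 v) inE ffunE eqxx su add1n.
congr _.+1; congr #|pred_of_set _|; apply/setP => w; rewrite !inE ffunE.
by case: (eqVneq w v) => // ->; rewrite (negbTE sv).
Qed.

Lemma ones_vote_loss v u : state x v -> ~~ state x u ->
  #|ones x| = #|ones (vote x v u)|.+1.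
Proof.
move=> sv su; rewrite (cardsD1 v) inE sv add1n.
congr _.+1; congr #|pred_of_set _|; apply/setP => w; rewrite !inE ffunE.
by case: (eqVneq w v) => // _; rewrite (negbTE su).
Qed.

(** The number of ones moves by [+1] or [-1] for the two orientations of the chosen edge, each with
    probability [q / 2], so the linear terms cancel for every centre [c]. *)
Lemma step_mean_ones c :
  step_mean (fun y => (#|ones y|%:R - c) ^+ 2) x = (#|ones x|%:R - c) ^+ 2 + q.
Proof.
set k : R := #|ones x|%:R.
have rw r o :
    rewire_mean (fun y : config N => (#|ones y|%:R - c) ^+ 2) x r o = (k - c) ^+ 2.
  rewrite rewire_meanE; case: (eqVneq _ finset.set0) => // Z0.
  by rewrite -[RHS](target_mean_cst _ Z0).
rewrite step_meanE// (eq_bigr (fun=> (k - c) ^+ 2 + q)).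
  by rewrite sumr_const -[X in _ * X]mulr_natl mulrA mulVf ?mul1r//
    pnatr_eq0 -lt0n card_arcs_gt0.
move=> [v u]; rewrite inE /= => /and3P[_ sv su]; rewrite /root_mean !rw.
rewrite (ones_vote_gain sv su) -/k -natr1 -/k.
have -> : #|ones (vote x u v)|%:R = k - 1.
  by rewrite /k (ones_vote_loss su sv) -natr1 addrK.
by set s := nu / L%:R; lra.
Qed.

End Discordant.
End OneStep.

(** * Potentials *)

Section Potentials.
Variables (R : realType) (N : nat).
Implicit Types (x y : config N) (v u r o z : 'I_N) (h : nat -> R).

(** Here [h] is the discrete derivative of the function of the degree that is being summed over the
    vertices. *)
Definition degree_potential h x : R :=
  \sum_v \sum_(j < deg (edges x) v) h j.

(** The factor [2^-1] compensates for the two orders of each pair; the diagonal contributes as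
    well. *)
Definition nonadjacency h x : R :=
  2^-1 * \sum_(d : 'I_N * 'I_N) (~~ adjacent (edges x) d.1 d.2)%:R *
    (h (deg (edges x) d.1) * h (deg (edges x) d.2)).

(** With [rho = 1 - q], a vertex in state 1 of degree [d] that loses an edge lowers its term by
    [q * rho ^+ d.-1]. This form is what makes the loss cancel against voting. *)
Definition ones_potential (rho : R) x : R :=
  \sum_v (state x v)%:R * (1 - rho ^+ deg (edges x) v).

(** * The ramp detecting degrees close to [N] *)

Section Ramp.
Variable kap : R.
Hypotheses (kap_gt0 : 0 < kap) (kap_le : kap <= 4^-1) (N_gt0 : (0 < N)%N).

(* Rises linearly from 0 at (1 - 2 kap) N to 1 at (1 - kap) N. *)
Definition ramp (d : nat) : R :=
  Num.min 1 (Num.max 0 ((d%:R - (1 - 2 * kap) * N%:R) / (kap * N%:R))).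

Let kN_gt0 : 0 < kap * N%:R. Proof. by rewrite mulr_gt0// ltr0n. Qed.

Lemma ramp_ge0 d : 0 <= ramp d.
Proof. by rewrite /ramp le_min ler01 le_max lexx. Qed.

Lemma ramp_le1 d : ramp d <= 1.
Proof. by rewrite /ramp ge_min lexx. Qed.

Lemma ramp_homo d d' : (d <= d')%N -> ramp d <= ramp d'.
Proof.
move=> dd'; rewrite /ramp le_min2// le_max2// ler_pM2r ?invr_gt0//.
by rewrite lerB// ler_nat.
Qed.

Lemma rampS d : ramp d.+1 <= ramp d + (kap * N%:R)^-1.
Proof.
rewrite /ramp -natr1 addrAC mulrDl mul1r.
set a := (_ / _); have : 0 < (kap * N%:R)^-1 by rewrite invr_gt0.
move: (_^-1) => e e0.
rewrite /Num.min /Num.max; do ![case: ifP => /=] => //; lra.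
Qed.

Lemma ramp_eq0 d : d%:R <= (1 - 2 * kap) * N%:R :> R -> ramp d = 0.
Proof.
move=> dN; rewrite /ramp (elimT max_idPl) ?minElt ?ltr10//.
by rewrite pmulr_lle0 ?invr_gt0// subr_le0.
Qed.

(** A root whose ramp is below 1 keeps about [kap * N] non-neighbours, so averaging over its targets
    instead of all vertices costs only a factor of order [1 / kap]. *)
Lemma ramp_neq1 d : ramp d != 1 -> d%:R <= (1 - kap) * N%:R :> R.
Proof.
apply: contraNT; rewrite -ltNge => dN; apply/eqP/min_idPl.
rewrite le_max; apply/orP; right; rewrite ler_pdivlMr// mul1r; lra.
Qed.

Lemma ramp_small d : (2 * d <= N)%N -> ramp d = 0.
Proof.
rewrite -(ler_nat R) natrM => dN; apply: ramp_eq0.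
have : kap * N%:R <= 4^-1 * N%:R by rewrite ler_wpM2r.
lra.
Qed.

(** The ramp vanishes up to [(1 - 2 kap) N] and is at most 1 beyond, so the sum is at most the
    overshoot. The indicator restricts a later sum over vertices to the few of degree at least
    [N / 2]. *)
Lemma sum_ramp_le d : (d <= N)%N ->
  \sum_(j < d) ramp j <= (N <= 2 * d)%N%:R * (2 * kap * N%:R).
Proof.
move=> dN; case: leqP => [_|/ltnW dN2]; last first.
  rewrite mul0r big1// => j _; apply: ramp_small.
  by apply: leq_trans dN2; rewrite leq_mul2l/= ltnW.
rewrite mul1r; suff H e : \sum_(j < e) ramp j <=
    Num.max 0 (e%:R - (1 - 2 * kap) * N%:R).
  apply: (le_trans (H d)); rewrite ge_max !(mulr_ge0, ltW kap_gt0)//=.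
  by move: dN; rewrite -(ler_nat R); lra.
elim: e => [|e IH]; first by rewrite big_ord0 le_max lexx.
rewrite big_ord_recr/= -natr1.
case: (lerP e%:R ((1 - 2 * kap) * N%:R)) => eN.
  rewrite ramp_eq0// addr0; apply: (le_trans IH).
  by rewrite max_l ?subr_le0// le_max lexx.
move: IH; rewrite max_r ?subr_ge0 ?(ltW eN)// => IH.
by rewrite le_max; apply/orP; right; move: (ramp_le1 e); lra.
Qed.

End Ramp.

(** * Increments of the potentials under a rewiring *)

Section Rewire.
Variables (x : config N) (r o z : 'I_N).
Hypotheses (sE : simple_graph (edges x)) (ro : adjacent (edges x) r o).
Hypothesis rz : z \in rewire_targets x r.

(** Only [o] loses and only [z] gains an edge. The dependence of [G] on the vertex lets it carry the
    states. *)
Lemma sum_deg_rewire (G : 'I_N -> nat -> R) :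
  \sum_w G w (deg (edges (rewire x r o z)) w) =
  \sum_w G w (deg (edges x) w)
  + (G z (deg (edges x) z).+1 - G z (deg (edges x) z))
  - (G o (deg (edges x) o) - G o (deg (edges x) o).-1).
Proof.
have oz := rewire_oz ro rz; have zo : z != o by rewrite eq_sym.
rewrite (bigD1 o)//= [in RHS](bigD1 o)//= (bigD1 z)//= [in RHS](bigD1 z)//=.
rewrite (deg_rewire_gained ro rz) (deg_rewire_lost sE ro rz)/=.
rewrite (eq_bigr (fun w => G w (deg (edges x) w))) => [|w /andP[wo wz]]; last first.
  by rewrite (deg_rewire_other sE ro rz).
ring.
Qed.

Lemma degree_potential_rewire h :
  degree_potential h (rewire x r o z) =
  degree_potential h x + h (deg (edges x) z) - h (deg (edges x) o).-1.
Proof.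
rewrite /degree_potential (sum_deg_rewire (fun _ d => \sum_(j < d) h j)).
rewrite big_ord_recr/= (deg_rewire_lost sE ro rz)/= big_ord_recr/=.
ring.
Qed.

Lemma ones_potential_rewire rho :
  ones_potential rho (rewire x r o z) = ones_potential rho x
  + (1 - rho) * ((state x z)%:R * rho ^+ deg (edges x) z
                 - (state x o)%:R * rho ^+ (deg (edges x) o).-1).
Proof.
rewrite /ones_potential (sum_deg_rewire (fun w d =>
  (state x w)%:R * (1 - rho ^+ d))) (deg_rewire_lost sE ro rz) succnK.
move: (deg (edges (rewire _ _ _ _)) o) (deg (edges x) z) => a b.
move: (\sum_w _) => s; rewrite (exprS rho a) (exprS rho b); ring.
Qed.

(** The pair [{r, o}] becomes nonadjacent and [{r, z}] adjacent, which gives the two products. Only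
    the degree of [z] goes up; this raises [h] by at most [e] there and affects only the pairs
    through [z], the diagonal one giving the extra 1. *)
Lemma nonadjacency_rewire h (e : R) :
  (forall d, 0 <= h d) -> {homo h : a b / (a <= b)%N >-> a <= b} ->
  (forall d, h d.+1 <= h d + e) -> 0 <= e <= 1 ->
  nonadjacency h (rewire x r o z) <= nonadjacency h x
  + h (deg (edges x) r) * h (deg (edges x) o)
  - h (deg (edges x) r) * h (deg (edges x) z)
  + e * (\sum_v h (deg (edges x) v) + 1).
Proof.
move=> h0 hh hS /andP[e0 e1].
have oz := rewire_oz ro rz.
have zr : z != r by move: rz; rewrite inE => /andP[].
have nrz : adjacent (edges x) r z = false.
  by move: rz; rewrite inE => /andP[_ /negbTE].
have r_neq_o : r != o by exact: adjacent_neq sE ro.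
pose E := edges x; pose E' := edges (rewire x r o z).
pose t v := h (deg E v).
pose n a b : R := (~~ adjacent E a b)%:R.
pose n' a b : R := (~~ adjacent E' a b)%:R.
(* The drop of the degree at [o] is discarded by monotonicity of [h]. *)
have t'_le w : h (deg E' w) <= t w + e * (w == z)%:R.
  case: (eqVneq w z) => [->|wz].
    by rewrite mulr1 /E' (deg_rewire_gained ro rz).
  rewrite mulr0 addr0; case: (eqVneq w o) => [->|wo].
    by rewrite /t /E (deg_rewire_lost sE ro rz) hh// ltnW.
  by rewrite /E' (deg_rewire_other sE ro rz).
have n'E a b : n' a b = n a b + ([set a; b] == [set r; o])%:R
                        - ([set a; b] == [set r; z])%:R.
  rewrite /n' /n (adjacent_rewire x r o z) -/E.
  case: (eqVneq [set a; b] [set r; o]) => [e1o|n1o] /=.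
    have -> : adjacent E a b by rewrite /adjacent e1o.
    rewrite e1o eq_set2 eqxx/= (negbTE oz) eq_sym (negbTE zr)/=; ring.
  case: (eqVneq [set a; b] [set r; z]) => [e1z|n1z] /=; last by ring.
  have -> : adjacent E a b = false by rewrite -nrz /adjacent e1z.
  by rewrite /=; ring.
have t0 w : 0 <= t w by exact: h0.
(* Both orders of the pair occur; the 2 cancels the [2^-1] in [nonadjacency]. *)
have sum_pair a b : a != b ->
    \sum_(d : 'I_N * 'I_N) ([set d.1; d.2] == [set a; b])%:R * (t d.1 * t d.2)
    = 2 * (t a * t b).
  move=> ab; rewrite (eq_bigr (fun d : 'I_N * 'I_N =>
    if [set d.1; d.2] == [set a; b] then t d.1 * t d.2 else 0)); last first.
    by move=> d _; case: eqP; rewrite ?mul1r ?mul0r.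
  by rewrite -big_mkcond sum_orientations//=; ring.
have step (d : 'I_N * 'I_N) :
    n' d.1 d.2 * (h (deg E' d.1) * h (deg E' d.2)) <=
    n d.1 d.2 * (t d.1 * t d.2)
    + ([set d.1; d.2] == [set r; o])%:R * (t d.1 * t d.2)
    - ([set d.1; d.2] == [set r; z])%:R * (t d.1 * t d.2)
    + e * ((d.1 == z)%:R * t d.2 + (d.2 == z)%:R * t d.1
           + (d.1 == z)%:R * (d.2 == z)%:R).
  rewrite -mulrDl -mulrBl -n'E; have n'01 : 0 <= n' d.1 d.2 <= 1.
    by rewrite /n'; case: (~~ _) => /=; rewrite ?lexx ?ler01.
  have : h (deg E' d.1) * h (deg E' d.2) <=
    (t d.1 + e * (d.1 == z)%:R) * (t d.2 + e * (d.2 == z)%:R).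
    by rewrite ler_pM.
  move: (t0 d.1) (t0 d.2) n'01; move: (n' _ _) (t d.1) (t d.2) (h _ * h _).
  move=> m t1 t2 H t10 t20 /andP[m0 m1] HH.
  have i0 (b : bool) : 0 <= (b%:R : R) by case: b.
  move: (i0 (d.1 == z)) (i0 (d.2 == z)) HH; move: (d.1 == z)%:R (d.2 == z)%:R.
  move=> i j i0' j0 HH.
  apply: (le_trans (ler_wpM2l m0 HH)).
  have -> : (t1 + e * i) * (t2 + e * j) =
    t1 * t2 + e * (i * t2 + j * t1 + e * (i * j)) by ring.
  rewrite mulrDr lerD2l.
  have A0 : 0 <= e * (i * t2 + j * t1 + e * (i * j)).
    by rewrite !(mulr_ge0, addr_ge0).
  apply: (le_trans (ler_piMl A0 m1)); rewrite ler_wpM2l// lerD2l.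
  by rewrite ler_piMl// mulr_ge0.
rewrite /nonadjacency -/E -/E' -/(t r) -/(t o) -/(t z).
have sum_z : \sum_(d : 'I_N * 'I_N) e * ((d.1 == z)%:R * t d.2
    + (d.2 == z)%:R * t d.1 + (d.1 == z)%:R * (d.2 == z)%:R) =
    e * (2 * \sum_v t v + 1).
  have S1 (s : 'I_N -> R) :
      \sum_(d : 'I_N * 'I_N) (d.1 == z)%:R * s d.2 = \sum_v s v.
    rewrite -(pair_bigA _ (fun a b => (a == z)%:R * s b))/=.
    rewrite (bigD1 z)//= [X in _ + X]big1 => [|a /negbTE->].
      by rewrite addr0; apply: eq_bigr => b _; rewrite eqxx mul1r.
    by rewrite big1// => b _; rewrite mul0r.
  have S2 : \sum_(d : 'I_N * 'I_N) (d.2 == z)%:R * t d.1 = \sum_v t v.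
    rewrite -(S1 t) -(pair_bigA _ (fun a b => (b == z)%:R * t a))/=.
    by rewrite exchange_big pair_bigA.
  have S3 : \sum_(d : 'I_N * 'I_N) (d.1 == z)%:R * (d.2 == z)%:R = 1 :> R.
    rewrite (S1 (fun b => (b == z)%:R)) (bigD1 z)//= eqxx big1 ?addr0//.
    by move=> a /negbTE->.
  rewrite -big_distrr/=; congr (_ * _); rewrite !big_split/= S1 S2 S3; ring.
have := ler_sum (index_enum _) (fun d (_ : xpredT d) => step d).
have r_neq_z : r != z by rewrite eq_sym.
rewrite !big_split/= sumrN !sum_pair// sum_z.
rewrite -/(n _ _) => le_s.
have := ler_wpM2l (_ : 0 <= 2^-1) le_s; rewrite invr_ge0 => /(_ (ler0n _ _)).
move=> H; apply: (le_trans H).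
have : 0 <= e by []. lra.
Qed.

End Rewire.
End Potentials.

(** * Graphs with [N * L / 2] edges: few large degrees, and the drift of the corrections *)

Section Sparse.
Variables (R : realType) (L N : nat) (x : config N).
Hypotheses (L_gt0 : (0 < L)%N) (N_gt0 : (0 < N)%N).
Hypotheses (sE : simple_graph (edges x)) (cE : (2 * #|edges x| = N * L)%N).
Implicit Types (v u r o z : 'I_N).

Definition half_degree : {set 'I_N} := [set v | (N <= 2 * deg (edges x) v)%N].

Let sum_degE : (\sum_v deg (edges x) v = N * L)%N.
Proof. by rewrite sum_deg. Qed.

Lemma deg_lt v : (deg (edges x) v < N)%N.
Proof. by rewrite -[X in (_ < X)%N](card_rewire_targets v sE) ltnS leq_addl. Qed.

(** Markov's inequality for the degrees, whose sum is [N * L]. *)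
Lemma card_half_degree : (#|half_degree| <= 2 * L)%N.
Proof.
rewrite -(leq_pmul2l N_gt0) mulnCA -sum_degE big_distrr/= -sum1_card.
rewrite big_distrr/= big_mkcond/=; apply: leq_sum => v _.
by rewrite inE muln1; case: ifP => [->|_]; rewrite ?leq0n.
Qed.

Lemma sum_high (K : nat) :
  K%:R * \sum_v (K * L <= deg (edges x) v)%N%:R <= N%:R :> R.
Proof.
rewrite -natr_sum -natrM ler_nat -(leq_pmul2r L_gt0) -sum_degE mulnAC.
rewrite big_distrr/=; apply: leq_sum => v _.
by case: (leqP (K * L) (deg (edges x) v)) => [le|_]; rewrite ?muln1 ?muln0.
Qed.

Section Kappa.
Variable kap : R.
Hypotheses (kap_gt0 : 0 < kap) (kap_le : kap <= 4^-1) (kapN : 2 <= kap * N%:R).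
Local Notation ramp := (ramp N kap).
Local Notation t v := (ramp (deg (edges x) v)).

Lemma ramp_half v : t v != 0 -> v \in half_degree.
Proof.
apply: contraNT; rewrite inE -ltnNge => /ltnW/(ramp_small kap_gt0 kap_le N_gt0)->.
by rewrite eqxx.
Qed.

Lemma sum_ramp_deg : \sum_v t v <= 2 * L%:R.
Proof.
apply: (@le_trans _ _ (\sum_(v in half_degree) 1)).
  rewrite [leRHS]big_mkcond; apply: ler_sum => v _; case: ifPn => [_|].
    exact: ramp_le1.
  by move/(contraNN (@ramp_half v)); rewrite negbK => /eqP->.
by rewrite sumr_const -natrM ler_nat card_half_degree.
Qed.

(** A root with ramp below 1 has at least [kap * N / 2] targets, so the mean of [g] is at most
    [2 S / (kap N)]. For a nearly full root only [g <= 1] is used, at the price of the indicator,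
    which the drift of [fullness] has to pay for. *)
Lemma target_mean_le r (g : 'I_N -> R) (c S : R) :
  0 <= c <= 1 -> (forall z, 0 <= g z <= 1) -> \sum_z g z <= S ->
  target_mean x r (fun z => g z - c) <=
  - c + (t r == 1)%:R + 2 * S / (kap * N%:R).
Proof.
move=> /andP[c0 c1] g01 gS.
have kN0 : 0 < kap * N%:R by apply: lt_le_trans kapN.
have S0 : 0 <= S by apply: le_trans gS; apply: sumr_ge0 => z _; case/andP: (g01 z).
have A0 : 0 <= 2 * S / (kap * N%:R) by rewrite divr_ge0 ?mulr_ge0// ltW.
have cZ : #|rewire_targets x r|%:R + (deg (edges x) r)%:R + 1 = N%:R :> R.
  by rewrite -natrD natr1 card_rewire_targets.
case: (eqVneq (t r) 1) => [_|/(ramp_neq1 kap_gt0 N_gt0) t1] /=.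
  apply: (@le_trans _ _ (1 - c)); last by rewrite mulr1n; lra.
  apply: (@le_trans _ _ (target_mean x r (fun=> 1 - c))).
    by apply: le_target_mean => z _; rewrite lerB// (andP (g01 z)).2.
  by apply: target_mean_cst_le; rewrite subr_ge0.
(* The root is not its own target; the missing 1 is absorbed by [2 <= kap * N]. *)
have Z_ge : kap * N%:R / 2 <= #|rewire_targets x r|%:R :> R.
  by move: kapN => kapN'; lra.
have Z_gt0 : 0 < #|rewire_targets x r|%:R :> R.
  by apply: lt_le_trans Z_ge; rewrite divr_gt0.
rewrite target_meanD target_mean_cst ?addr0; last first.
  by rewrite -card_gt0 -(ltr0n R).
rewrite addrC lerD2l /target_mean -big_distrr/= mulrC.
rewrite ler_pdivrMr//; apply: (@le_trans _ _ S).
  apply: le_trans gS; rewrite [leLHS]big_mkcond; apply: ler_sum => z _.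
  by case: ifP => // _; case/andP: (g01 z).
rewrite mulrAC -[leLHS](mulfK (lt0r_neq0 kN0)) ler_pM2r ?invr_gt0//.
have := ler_wpM2l S0 Z_ge; lra.
Qed.

(** The correction [H_i] of the introductory comment, for [kap = kap1] or [kap2]. *)
Definition fullness (y : config N) : R :=
  degree_potential ramp y + nonadjacency ramp y.

(** The degree part gives [t z - t o] up to one step of the ramp, the nonadjacency part gives
    [t r * (t o - t z)]; together they factor through [1 - t r]. *)
Lemma fullness_rewire r o z :
  adjacent (edges x) r o -> z \in rewire_targets x r ->
  fullness (rewire x r o z) - fullness x <=
  (1 - t r) * (t z - t o) + (2 * L%:R + 2) / (kap * N%:R).
Proof.
move=> ro rz; have kN0 : 0 < kap * N%:R by apply: lt_le_trans kapN.
have e01 : 0 <= (kap * N%:R)^-1 <= 1.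
  by rewrite invr_ge0 ltW//= invf_le1//; apply: le_trans kapN; rewrite ler1n.
have := nonadjacency_rewire sE ro rz (@ramp_ge0 R N kap)
  (ramp_homo kap_gt0 N_gt0) (rampS kap_gt0 N_gt0) e01.
rewrite /fullness (degree_potential_rewire sE ro rz).
have := rampS kap_gt0 N_gt0 (deg (edges x) o).-1.
rewrite prednK; last by rewrite (deg_rewire_lost sE ro rz).
have := ler_wpM2l (andP e01).1 (lerD sum_ramp_deg (lexx 1)).
lra.
Qed.

(** The factor [1 - t r] vanishes exactly at the roots where averaging over targets fails, so the
    indicator of [target_mean_le] drops out. *)
Lemma target_mean_fullness r o : adjacent (edges x) r o ->
  target_mean x r (fun z => fullness (rewire x r o z) - fullness x) <=
  - (1 - t r) * t o + 8 * L%:R / (kap * N%:R).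
Proof.
move=> ro; have kN0 : 0 < kap * N%:R by apply: lt_le_trans kapN.
have L1 : 1 <= L%:R :> R by rewrite ler1n.
set c := (2 * L%:R + 2) / (kap * N%:R).
have c0 : 0 <= c by rewrite divr_ge0 ?ltW// addr_ge0// mulr_ge0.
apply: (@le_trans _ _ (target_mean x r (fun z => (1 - t r) * (t z - t o) + c))).
  by apply: le_target_mean => z rz; apply: fullness_rewire.
have H : (2 * (2 * L%:R) + (2 * L%:R + 2)) / (kap * N%:R) <=
    8 * L%:R / (kap * N%:R).
  by rewrite ler_pM2r ?invr_gt0//; lra.
rewrite target_meanD target_meanZ.
have le2 := target_mean_cst_le x r c0.
have le1 : target_mean x r (fun z => t z - t o) <=
    - t o + (t r == 1)%:R + 2 * (2 * L%:R) / (kap * N%:R).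
  by apply: target_mean_le => [|z|]; rewrite ?ramp_ge0 ?ramp_le1 ?sum_ramp_deg.
move: le1; case: (eqVneq (t r) 1) => [->|t1] /= le1.
  rewrite subrr oppr0 !mul0r !add0r; apply: (le_trans le2).
  by apply: le_trans H; rewrite ler_pM2r ?invr_gt0//; lra.
have t0 : 0 <= 1 - t r by rewrite subr_ge0 ramp_le1.
have t1' : 1 - t r <= 1 by rewrite lerBlDr lerDl ramp_ge0.
have A0 : 0 <= 2 * (2 * L%:R) / (kap * N%:R) 
  by apply: divr_ge0; [rewrite !mulr_ge0|exact: ltW].
have := ler_wpM2l t0 le1; have := ler_piMl A0 t1'.
move: le2 H; rewrite /c ![(_ + _) / _]mulrDl; lra.
Qed.

(** At most [2 * L] vertices have degree at least [N / 2]. Each adds at most [2 * kap * N] to the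
    degree part, and the pairs add at most half of [(2 L)^2]. *)
Lemma fullness_le : fullness x <= 4 * kap * (N%:R * L%:R) + 2 * L%:R ^+ 2.
Proof.
have kap0 := ltW kap_gt0; apply: lerD.
  apply: (@le_trans _ _ (\sum_(v in half_degree) (2 * kap * N%:R))).
    rewrite [leRHS]big_mkcond/=; apply: ler_sum => v _.
    apply: (le_trans (sum_ramp_le kap_gt0 kap_le N_gt0 (ltnW (deg_lt v)))).
    by rewrite inE; case: ifP; rewrite ?mul1r ?mul0r.
  rewrite sumr_const -mulr_natl.
  have H : #|half_degree|%:R <= 2 * L%:R :> R.
    by rewrite -natrM ler_nat card_half_degree.
  have := ler_wpM2r (_ : 0 <= 2 * kap * N%:R) H.
  by rewrite !mulr_ge0// => /(_ isT); lra.
rewrite /nonadjacency; have := sum_ramp_deg.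
set S := \sum_v _ => S2.
have S0 : 0 <= S by apply: sumr_ge0 => v _; apply: ramp_ge0.
have : \sum_(d : 'I_N * 'I_N) (~~ adjacent (edges x) d.1 d.2)%:R *
    (t d.1 * t d.2) <= S * S.
  rewrite /S big_distrl/=; under [leRHS]eq_bigr do rewrite big_distrr/=.
  rewrite pair_bigA/=; apply: ler_sum => d _.
  by rewrite ler_piMl ?mulr_ge0 ?ramp_ge0//; case: (~~ _).
move=> le1; have := ler_pM S0 S0 S2 S2; rewrite expr2; lra.
Qed.

End Kappa.
End Sparse.

(** The arithmetic of one discordant edge, with [v] in state 0 and [u] in state 1. [Mv] and [Mu] are
    the rewiring drifts for the two roots, [c] and [a] the powers of [1 - q] at [v] and at [u] after
    its loss, [cv] and [cu] flag degrees above [K L], [t] and [b] are ramps and indicators of a full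
    ramp, [hv] and [hu] flag degrees at least [N / 2]. The terms in [a] cancel and leave
    [- s * c]. *)
Lemma arc_drift_ineq (R : realFieldType) (s q a c cu eta1 eta2 e1 e2 Mv Mu
    t1v t1u t2v t2u b1v b1u b2v b2u : R) (cv hv hu : bool) :
  0 <= q <= 2^-1 -> 0 <= s -> 0 <= a <= 1 -> 0 <= c <= 1 -> 0 <= cu ->
  0 <= eta1 -> 0 <= eta2 -> 0 <= e1 -> 0 <= e2 ->
  (~~ cv -> 1 <= s * c) ->
  [/\ 0 <= t1v <= 1, 0 <= t1u <= 1, 0 <= t2v <= 1 & 0 <= t2u <= 1] ->
  [/\ b1v <= t1v, b1u <= t1u, b2v <= t2v & b2u <= t2u] ->
  [/\ t1v != 0 -> hv, t1u != 0 -> hu, t2v != 0 -> hv & t2u != 0 -> hu] ->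
  Mv <= - cu + b1v + eta1 + (- (1 - t1v) * t1u + e1)
        + s * (- (1 - t2v) * t2u + e2) + s * (- a + b2v + eta2) ->
  Mu <= - cv%:R + b1u + eta1 + (- (1 - t1u) * t1v + e1)
        + s * (- (1 - t2u) * t2v + e2) + s * (b2u + eta2) ->
  s * (1 - c) - s * (1 - (1 - q) * a) + (1 - q) * (Mv + Mu) <=
  2 * (- 2^-1 + q / 2 + (eta1 + e1 + s * e2 + s * eta2)
       + (hv && hu)%:R * (3 / 2 + s)).
Proof.
move=> /andP[q0 q1] s0 /andP[a0 a1] /andP[c0 c1] cu0 eta10 eta20 e10 e20 low.
move=> [/andP[t1v0 t1v1] /andP[t1u0 t1u1] /andP[t2v0 t2v1] /andP[t2u0 t2u1]].
move=> [b1v_le b1u_le b2v_le b2u_le] [h1v h1u h2v h2u] HMv HMu.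
pose X (tv tu bv bu : R) := bv + bu - (1 - tv) * tu - (1 - tu) * tv.
set E := eta1 + e1 + s * e2 + s * eta2.
have E0 : 0 <= E by rewrite !addr_ge0 ?mulr_ge0.
have HM : Mv + Mu <= - cv%:R + X t1v t1u b1v b1u + s * X t2v t2u b2v b2u
    - s * a + 2 * E by rewrite /X /E; lra.
have q' : 0 <= 1 - q by lra.
have HM' := ler_wpM2l q' HM.
(* As [bv <= tv] and [bu <= tu], [X] is at most [2 * tv * tu], nonzero only if both ends have large
   degree. *)
have X_le (tv tu bv bu : R) : 0 <= tv <= 1 -> 0 <= tu <= 1 ->
    bv <= tv -> bu <= tu -> (tv != 0 -> hv) -> (tu != 0 -> hu) ->
    X tv tu bv bu <= 2 * (hv && hu)%:R.
  move=> /andP[tv0 tv1] /andP[tu0 tu1] bv_le bu_le hhv hhu; rewrite /X.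
  have Hvu : 0 <= tv * tu by rewrite mulr_ge0.
  case: (boolP hv) => [hv1|/negP hv0]; last first.
    have t_0 : tv = 0 by apply/eqP/negPn/negP => /hhv.
    by rewrite t_0 /= in bv_le *; lra.
  case: (boolP hu) => [hu1|/negP hu0] /=; last first.
    have t_0 : tu = 0 by apply/eqP/negPn/negP => /hhu.
    by rewrite t_0 /= in bu_le *; lra.
  have : tv * tu <= 1 by rewrite mulr_ile1.
  lra.
have X1 : X t1v t1u b1v b1u <= 2 * (hv && hu)%:R by apply: X_le => //; apply/andP.
have X2 : X t2v t2u b2v b2u <= 2 * (hv && hu)%:R by apply: X_le => //; apply/andP.
have b0 : 0 <= (hv && hu)%:R :> R by [].
have A1 : (1 - q) * (X t1v t1u b1v b1u) <= 2 * (hv && hu)%:R.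
  apply: (le_trans (ler_wpM2l q' X1)); have := mulr_ge0 q0 b0; lra.
have A2 : (1 - q) * (s * X t2v t2u b2v b2u) <= s * (2 * (hv && hu)%:R).
  rewrite mulrCA; apply: ler_wpM2l => //.
  apply: (le_trans (ler_wpM2l q' X2)); have := mulr_ge0 q0 b0; lra.
have A3 : (1 - q) * E <= E by have := mulr_ge0 q0 E0; lra.
(* Either [v] has high degree and the first potential gains [1 - q], or [s * c] is at least 1. *)
have A4 : - (s * c) - (1 - q) * cv%:R <= - 1 + q.
  have sc0 : 0 <= s * c by rewrite mulr_ge0.
  by case: cv low {HMu HM HM'} => /= low; [|have := low isT]; lra.
by move: HM'; lra.
Qed.

(** * Drift of the Lyapunov function *)

Section Lyapunov.
Variables (R : realType) (nu : R) (L N K : nat) (kap1 kap2 beta : R).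
Local Notation q := (nu / L%:R).
Local Notation rho := (1 - q).
Local Notation step_mean := (step_mean nu L).
Implicit Types (x y : config N) (v u r o z : 'I_N).

(** Discrete derivative of the positive part of [d - K L]. *)
Definition high_degree (d : nat) : R := (K * L <= d)%N%:R.

Definition lyapunov x : R :=
  degree_potential high_degree x + fullness kap1 x
  + beta * nu * fullness kap2 x + beta * L%:R * ones_potential rho x.

Section Drift.
Variable x : config N.
Hypotheses (L_gt0 : (0 < L)%N) (N_gt0 : (0 < N)%N) (K_gt0 : (0 < K)%N).
Hypotheses (sE : simple_graph (edges x)) (cE : (2 * #|edges x| = N * L)%N).
Hypotheses (nu_gt0 : 0 < nu) (q_le : q <= 2^-1) (beta_gt0 : 0 < beta).
Hypotheses (kap1_gt0 : 0 < kap1) (kap1_le : kap1 <= 4^-1).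
Hypotheses (kap2_gt0 : 0 < kap2) (kap2_le : kap2 <= 4^-1).
Hypotheses (kap1N : 4 * L%:R <= kap1 * N%:R :> R)
  (kap2N : 4 * L%:R <= kap2 * N%:R :> R).

Local Notation t1 v := (ramp N kap1 (deg (edges x) v)).
Local Notation t2 v := (ramp N kap2 (deg (edges x) v)).

Let q_ge0 : 0 <= q. Proof. by rewrite divr_ge0// ltW. Qed.

Let LR_gt0 : 0 < L%:R :> R. Proof. by rewrite ltr0n. Qed.

Let Lq : L%:R * q = nu. Proof. by rewrite mulrC divfK// lt0r_neq0. Qed.

Let rho01 d : 0 <= rho ^+ d <= 1.
Proof.
have q0 := q_ge0; have q1 := q_le.
by rewrite exprn_ge0 ?exprn_ile1//; lra.
Qed.

Let kapN (kap : R) : 4 * L%:R <= kap * N%:R :> R -> 2 <= kap * N%:R :> R.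
Proof. by move=> h; have L1 : 1 <= L%:R :> R; [rewrite ler1n|lra]. Qed.

Lemma deg_adjacent_gt0 v u : adjacent (edges x) v u -> (0 < deg (edges x) v)%N.
Proof. by move=> vu; rewrite card_gt0; apply/set0Pn; exists u; rewrite inE. Qed.

(** The edge lost by [o] is weighed at degree [d - 1], which makes the inequality at [o] strict. *)
Lemma high_degree_rewire r o z :
  adjacent (edges x) r o -> z \in rewire_targets x r ->
  degree_potential high_degree (rewire x r o z) - degree_potential high_degree x
  = high_degree (deg (edges x) z) - (K * L < deg (edges x) o)%N%:R.
Proof.
move=> ro rz; rewrite (degree_potential_rewire sE ro rz).
have : (0 < deg (edges x) o)%N by rewrite (@deg_adjacent_gt0 o r)// adjacentC.
by rewrite /high_degree; case: (deg _ o) => // d _ /=; rewrite ltnS; ring.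
Qed.

(** By [sum_high] at most [N / K] vertices have degree [K L] or more; spread over at least
    [kap1 * N / 2] targets this gives the error [2 / (K kap1)]. *)
Lemma target_mean_high r o : adjacent (edges x) r o ->
  target_mean x r (fun z => degree_potential high_degree (rewire x r o z)
                            - degree_potential high_degree x) <=
  - (K * L < deg (edges x) o)%N%:R + (t1 r == 1)%:R + 2 / (K%:R * kap1).
Proof.
move=> ro; apply: (@le_trans _ _ (target_mean x r (fun z =>
    high_degree (deg (edges x) z) - (K * L < deg (edges x) o)%N%:R))).
  by apply: le_target_mean => z rz; rewrite high_degree_rewire.
have -> : 2 / (K%:R * kap1) = 2 * (N%:R / K%:R) / (kap1 * N%:R).
  by field; rewrite !pnatr_eq0 -!lt0n N_gt0 K_gt0 lt0r_neq0.
apply: target_mean_le => //; first exact: kapN.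
- by case: ltnP; rewrite ?lexx ?ler01.
- by move=> z; rewrite /high_degree; case: (_ <= _)%N; rewrite ?lexx ?ler01.
- by rewrite ler_pdivlMr ?ltr0n// mulrC sum_high.
Qed.

(** The regained part is bounded by the share of state 1 among the targets, which is small as long
    as state 1 is rare. *)
Lemma target_mean_ones r o : adjacent (edges x) r o ->
  target_mean x r (fun z => ones_potential rho (rewire x r o z)
                            - ones_potential rho x) <=
  q * (- ((state x o)%:R * rho ^+ (deg (edges x) o).-1) + (t2 r == 1)%:R
       + 2 * #|ones x|%:R / (kap2 * N%:R)).
Proof.
move=> ro; apply: (@le_trans _ _ (target_mean x r (fun z =>
    q * ((state x z)%:R * rho ^+ deg (edges x) z
         - (state x o)%:R * rho ^+ (deg (edges x) o).-1)))).
  apply: le_target_mean => z rz.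
  by rewrite (ones_potential_rewire sE ro rz) addrAC subrr add0r subKr.
have b01 (b : bool) d : 0 <= b%:R * rho ^+ d <= 1.
  by case: b; rewrite ?mul1r ?mul0r ?lexx ?ler01 ?rho01.
rewrite target_meanZ ler_wpM2l//; apply: target_mean_le => //; first exact: kapN.
rewrite /ones -sum1_card natr_sum [leRHS]big_mkcond/=; apply: ler_sum => z _.
rewrite inE; case: (state x z); rewrite ?mul1r ?mul0r//.
by case/andP: (rho01 (deg (edges x) z)).
Qed.

Lemma lyapunov_vote v u : lyapunov (vote x v u) - lyapunov x =
  beta * L%:R * (((state x u)%:R - (state x v)%:R)
                 * (1 - rho ^+ deg (edges x) v)).
Proof.
rewrite /lyapunov -[degree_potential _ (vote _ _ _)]/(degree_potential _ x).
rewrite -[fullness kap1 (vote _ _ _)]/(fullness kap1 x).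
rewrite -[fullness kap2 (vote _ _ _)]/(fullness kap2 x).
have -> : ones_potential rho (vote x v u) = ones_potential rho x +
    ((state x u)%:R - (state x v)%:R) * (1 - rho ^+ deg (edges x) v).
  rewrite /ones_potential (bigD1 v)//= [in RHS](bigD1 v)//= ffunE eqxx.
  rewrite (eq_bigr (fun w => (state x w)%:R * (1 - rho ^+ deg (edges x) w))).
    move: (\sum_(i < N | _) _) (1 - rho ^+ deg (edges x) v) => S T.
    move: (state x u)%:R (state x v)%:R => a b.
    by rewrite addrAC -mulrDl (addrC b) subrK.
  by move=> w /negbTE wv; rewrite ffunE wv.
by rewrite (mulrDr _ (ones_potential rho x)) addrA [_ + _ - _]addrAC subrr add0r.
Qed.

(** Sum of the four drifts; the weight [beta * L] meets the factor [q] of the last one and leaves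
    [beta * nu]. *)
Lemma target_mean_lyapunov r o : adjacent (edges x) r o ->
  target_mean x r (fun z => lyapunov (rewire x r o z) - lyapunov x) <=
  (- (K * L < deg (edges x) o)%N%:R + (t1 r == 1)%:R + 2 / (K%:R * kap1))
  + (- (1 - t1 r) * t1 o + 8 * L%:R / (kap1 * N%:R))
  + beta * nu * (- (1 - t2 r) * t2 o + 8 * L%:R / (kap2 * N%:R))
  + beta * nu * (- ((state x o)%:R * rho ^+ (deg (edges x) o).-1)
                 + (t2 r == 1)%:R + 2 * #|ones x|%:R / (kap2 * N%:R)).
Proof.
move=> ro; have bn0 : 0 <= beta * nu by rewrite mulr_ge0 ?ltW.
have bL0 : 0 <= beta * L%:R by rewrite mulr_ge0 ?ltW.
have H4 := ler_wpM2l bL0 (target_mean_ones ro).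
have qL : beta * L%:R * q = beta * nu by rewrite -mulrA Lq.
rewrite [leRHS]mulrA qL in H4.
have H3 := ler_wpM2l bn0 (target_mean_fullness L_gt0 N_gt0 sE cE kap2_gt0
  kap2_le (kapN kap2N) ro).
have H2 := target_mean_fullness L_gt0 N_gt0 sE cE kap1_gt0
  kap1_le (kapN kap1N) ro.
have H1 := target_mean_high ro.
apply: le_trans (lerD (lerD (lerD H1 H2) H3) H4).
rewrite -!target_meanZ -!target_meanD; apply: le_target_mean => z _.
have E (a b c d a' b' c' d' m n : R) :
  a' + b' + m * c' + n * d' - (a + b + m * c + n * d) =
  (a' - a) + (b' - b) + m * (c' - c) + n * (d' - d) by ring.
by rewrite /lyapunov E.
Qed.

Definition lyapunov_error : R :=
  2 / (K%:R * kap1) + 8 * L%:R / (kap1 * N%:R)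
  + beta * nu * (8 * L%:R / (kap2 * N%:R))
  + beta * nu * (2 * #|ones x|%:R / (kap2 * N%:R)).

Hypothesis low_degree :
  forall d, (d <= K * L)%N -> 1 <= beta * nu * rho ^+ d.

Lemma arc_drift v u :
  adjacent (edges x) v u -> ~~ state x v -> state x u ->
  root_mean nu L (fun y => lyapunov y - lyapunov x) x v u
  + root_mean nu L (fun y => lyapunov y - lyapunov x) x u v <=
  2 * (- 2^-1 + q / 2 + lyapunov_error +
    ((v \in half_degree x) && (u \in half_degree x))%:R * (3 / 2 + beta * nu)).
Proof.
move=> vu sv su; have uv : adjacent (edges x) u v by rewrite adjacentC.
rewrite /root_mean !rewire_mean_diff !lyapunov_vote su (negbTE sv).
have := target_mean_lyapunov vu; have := target_mean_lyapunov uv.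
rewrite su (negbTE sv).
set Mu := target_mean x u _; set Mv := target_mean x v _.
(* Writing the voting term at [u] with the power after the loss of an edge exposes the factor
   [1 - q] needed for the cancellation. *)
have rS : rho ^+ deg (edges x) u = rho * rho ^+ (deg (edges x) u).-1.
  by rewrite -exprS prednK// (deg_adjacent_gt0 uv).
rewrite rS mul1r mul0r oppr0 add0r => HMu HMv.
have bn0 : 0 <= beta * nu by rewrite mulr_ge0 ?ltW.
have kN0 (kap : R) : 0 < kap -> 0 <= (kap * N%:R)^-1.
  by move=> /ltW k0; rewrite invr_ge0 mulr_ge0.
have eq1_le (kap : R) w : (ramp N kap (deg (edges x) w) == 1)%:R <=
    ramp N kap (deg (edges x) w).
  by case: eqP => [->//|_]; rewrite ramp_ge0.
have := @arc_drift_ineq R (beta * nu) q (rho ^+ (deg (edges x) u).-1)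
  (rho ^+ deg (edges x) v) (K * L < deg (edges x) u)%N%:R
  (2 / (K%:R * kap1)) (2 * #|ones x|%:R / (kap2 * N%:R))
  (8 * L%:R / (kap1 * N%:R)) (8 * L%:R / (kap2 * N%:R)) Mv Mu
  (t1 v) (t1 u) (t2 v) (t2 u) (t1 v == 1)%:R (t1 u == 1)%:R
  (t2 v == 1)%:R (t2 u == 1)%:R (K * L < deg (edges x) v)%N
  (v \in half_degree x) (u \in half_degree x).
rewrite q_ge0 q_le !rho01 !ramp_ge0 !ramp_le1 !eq1_le bn0 ler0n.
have -> : 0 <= 2 / (K%:R * kap1) by rewrite divr_ge0// mulr_ge0// ltW.
rewrite !mulr_ge0 ?kN0// => /(_ isT isT isT isT isT isT isT isT isT).
have low : ~~ (K * L < deg (edges x) v)%N -> 1 <= beta * nu * rho ^+ deg (edges x) v.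
  by rewrite -leqNgt => /low_degree.
move=> /(_ low (And4 isT isT isT isT) (And4 isT isT isT isT)).
have hd (kap : R) : 0 < kap -> kap <= 4^-1 -> forall w,
    ramp N kap (deg (edges x) w) != 0 -> w \in half_degree x.
  by move=> k0 k1 w; apply: ramp_half.
move=> /(_ (And4 (hd _ kap1_gt0 kap1_le v) (hd _ kap1_gt0 kap1_le u)
  (hd _ kap2_gt0 kap2_le v) (hd _ kap2_gt0 kap2_le u)) HMv HMu).
rewrite /lyapunov_error; apply: le_trans.
have E (b l s r n A B M M' : R) : l * s = n ->
    s * (b * l * ((1 + 0) * A)) + r * M + (s * (b * l * ((0 - 1) * B)) + r * M') =
    b * n * A - b * n * B + r * (M + M') by move=> <-; ring.
by rewrite le_eqVlt; apply/orP; left; apply/eqP; exact: E Lq.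
Qed.

(** Fix [u] in state 1 of degree at least [N / 2]. As at most [N / 4] vertices are in state 1, at
    least [N / 4] arcs end at [u], while at most [2 * L] of them start at a vertex of large degree.
    The bound follows by summing over [u]. *)
Lemma rare_arcs : (4 * #|ones x| <= N)%N ->
  (N * \sum_(d in arcs x) ((d.1 \in half_degree x) && (d.2 \in half_degree x))
   <= 8 * L * #|arcs x|)%N.
Proof.
move=> ones_le; set H := half_degree x; rewrite -[#|arcs x|]sum1_card.
rewrite (partition_big (fun d : 'I_N * 'I_N => d.2) xpredT)//=.
rewrite [X in (_ <= _ * X)%N](partition_big (fun d : 'I_N * 'I_N => d.2) xpredT)//=.
rewrite !big_distrr/=; apply: leq_sum => u _.
pose B := [set d in arcs x | d.2 == u].
(* Among the arcs ending at [u], an arc is determined by its first end. *)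
have fst_inj (C : {set 'I_N * 'I_N}) : C \subset B -> #|fst @: C| = #|C|.
  move=> CB; apply: card_in_imset => -[v1 u1] [v2 u2].
  by move=> /(fintype.subsetP CB) + /(fintype.subsetP CB);
    rewrite !inE/= => /andP[_ /eqP->] /andP[_ /eqP->] ->.
have -> : (\sum_(d in arcs x | d.2 == u) 1 = #|B|)%N.
  by rewrite -sum1_card; apply: eq_bigl => d; rewrite !inE.
have -> : (\sum_(d in arcs x | d.2 == u) ((d.1 \in H) && (d.2 \in H)) =
           (u \in H) * #|[set d in B | d.1 \in H]|)%N.
  rewrite -sum1_card big_distrr/= [RHS]big_mkcond [LHS]big_mkcond/=.
  apply: eq_bigr => -[v w] _; rewrite !inE/=.
  case: (eqVneq w u) => [->|]; rewrite ?andbT ?andbF//=.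
  case: [&& adjacent _ _ _, _ & _]; case: (N <= _)%N; by case: (N <= _)%N.
case: (boolP (u \in H)) => [uH|_]; last by rewrite mul0n muln0.
rewrite mul1n; set C := [set d in B | _].
have CB : C \subset B by apply/fintype.subsetP => d; rewrite inE => /andP[].
have C_le : (#|C| <= 2 * L)%N.
  rewrite -fst_inj//; apply: leq_trans (card_half_degree N_gt0 sE cE).
  apply/subset_leq_card/fintype.subsetP => v /imsetP[d].
  by rewrite inE => /andP[_ dH] ->.
case: (posnP #|C|) => [->|/card_gt0P[d dC]]; first by rewrite muln0.
have su : state x u.
  by move: dC; rewrite !inE => /andP[/andP[/and3P[_ _ s2] /eqP <-]].
have B_ge : (deg (edges x) u <= #|B| + #|ones x|)%N.
  rewrite -(fst_inj B)//; apply: leq_trans (leq_card_setU _ _).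
  apply/subset_leq_card/fintype.subsetP => v; rewrite !inE => uv.
  case: (boolP (state x v)) => sv; rewrite ?orbT// orbF.
  by apply/imsetP; exists (v, u); rewrite // !inE/= adjacentC uv sv su eqxx.
move: uH; rewrite inE => uH.
have N_le : (N <= 4 * #|B|)%N.
  have A (n m b k : nat) :
    (n <= 2 * m -> m <= b + k -> 4 * k <= n -> n <= 4 * b)%N by clear; lia.
  exact: A uH B_ge ones_le.
apply: leq_trans (leq_mul N_le C_le) _.
by rewrite mulnACA (mulnC #|B|) mulnA.
Qed.

(** Average of [arc_drift] over the arcs; those with two ends of large degree have proportion at
    most [8 L / N]. *)
Lemma lyapunov_drift : (4 * #|ones x| <= N)%N ->
  discordant x != finset.set0 ->
  step_mean (fun y => lyapunov y - lyapunov x) x <=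
  - 2^-1 + q / 2 + lyapunov_error
  + 8 * L%:R / N%:R * (3 / 2 + beta * nu).
Proof.
move=> ones_le D0; have arcs_gt0 := card_arcs_gt0 R sE D0.
have a0 : (0 : R) < #|arcs x|%:R by rewrite ltr0n.
pose c (d : 'I_N * 'I_N) : R := - 2^-1 + q / 2 + lyapunov_error +
  ((d.1 \in half_degree x) && (d.2 \in half_degree x))%:R * (3 / 2 + beta * nu).
apply: (le_trans (step_mean_arcs_le (c := c) sE D0 _)).
  by move=> d; rewrite inE => /and3P[]; apply: arc_drift.
rewrite /c big_split/= sumr_const -big_distrl/= -natr_sum mulrDr.
rewrite -[X in _^-1 * X + _]mulr_natl mulrA mulVf ?lt0r_neq0// mul1r.
rewrite lerD2l mulrA ler_wpM2r//.
  by rewrite addr_ge0// mulr_ge0// ltW.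
have := rare_arcs ones_le; rewrite -(ler_nat R) !natrM => le_r.
rewrite ler_pdivlMr ?ltr0n// -mulrA ler_pdivrMl//.
by rewrite mulrC (mulrC #|arcs x|%:R).
Qed.

(** The four parts rise by at most 1, 2, [2 * (beta * nu)] and [beta * nu]. *)
Lemma lyapunov_rewire_le r o z :
  adjacent (edges x) r o -> z \in rewire_targets x r ->
  lyapunov (rewire x r o z) - lyapunov x <= 3 + 3 * (beta * nu).
Proof.
move=> ro rz.
have L1 : 1 <= L%:R :> R by rewrite ler1n.
have F (kap : R) : 0 < kap -> kap <= 4^-1 -> 4 * L%:R <= kap * N%:R :> R ->
    fullness kap (rewire x r o z) - fullness kap x <= 2.
  move=> k0 k1 k2.
  have fr := fullness_rewire N_gt0 sE cE k0 k1 (kapN k2) ro rz.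
  have tt : (1 - ramp N kap (deg (edges x) r)) *
     (ramp N kap (deg (edges x) z) - ramp N kap (deg (edges x) o)) <= 1.
    move: (ramp_ge0 N kap (deg (edges x) r)) (ramp_le1 N kap (deg (edges x) r)).
    move: (ramp_ge0 N kap (deg (edges x) z)) (ramp_le1 N kap (deg (edges x) z)).
    move: (ramp_ge0 N kap (deg (edges x) o)).
    move: (ramp N kap _) (ramp N kap _) (ramp N kap _) => a b c c0 a0 a1 b0 b1.
    nra.
  have : (2 * L%:R + 2) / (kap * N%:R) <= 1.
    by rewrite ler_pdivrMr; [lra|apply: lt_le_trans k2; lra].
  move: fr tt. lra.
have bn0 : 0 <= beta * nu by rewrite mulr_ge0 ?ltW.
have H1 : degree_potential high_degree (rewire x r o z)
    - degree_potential high_degree x <= 1.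
  rewrite high_degree_rewire// /high_degree.
  by case: (_ <= _)%N; case: (_ < _)%N; rewrite ?subr0 ?subrr ?sub0r ?lexx ?ler01 ?lerN10.
have H2 := F _ kap1_gt0 kap1_le kap1N.
have H3 := ler_wpM2l bn0 (F _ kap2_gt0 kap2_le kap2N).
have H4 : beta * L%:R * (ones_potential rho (rewire x r o z) - ones_potential rho x)
    <= beta * nu.
  rewrite (ones_potential_rewire sE ro rz) addrAC subrr add0r subKr.
  rewrite mulrA -(mulrA beta) Lq ler_piMr// lerBlDr.
  have b01 (b : bool) d : 0 <= b%:R * rho ^+ d <= 1.
    by case: b; rewrite ?mul1r ?mul0r ?lexx ?ler01 ?rho01.
  move: (b01 (state x z) (deg (edges x) z)) (b01 (state x o) (deg (edges x) o).-1).
  by move=> /andP[_ h1] /andP[h2 _]; apply: (le_trans h1); rewrite lerDl.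
have E (a b c d a' b' c' d' m n : R) :
  a' + b' + m * c' + n * d' - (a + b + m * c + n * d) =
  (a' - a) + (b' - b) + m * (c' - c) + n * (d' - d) by ring.
rewrite /lyapunov E; apply: (le_trans (lerD (lerD (lerD H1 H2) H3) H4)).
by move: bn0; move: (beta * nu) => s s0; lra.
Qed.

Lemma lyapunov_ge0 : 0 <= lyapunov x.
Proof.
have F (kap : R) : 0 <= fullness kap x.
  rewrite addr_ge0//.
    by apply: sumr_ge0 => v _; apply: sumr_ge0 => j _; apply: ramp_ge0.
  rewrite mulr_ge0 ?invr_ge0//; apply: sumr_ge0 => d _.
  by rewrite !mulr_ge0// ramp_ge0.
have bn0 : 0 <= beta * nu by rewrite mulr_ge0 ?(ltW beta_gt0) ?(ltW nu_gt0).
have bL0 : 0 <= beta * L%:R by rewrite mulr_ge0 ?(ltW beta_gt0).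
rewrite /lyapunov; apply: addr_ge0; first apply: addr_ge0; first apply: addr_ge0.
- by apply: sumr_ge0 => v _; apply: sumr_ge0 => j _.
- exact: F.
- by rewrite mulr_ge0.
- rewrite mulr_ge0//; apply: sumr_ge0 => v _; rewrite mulr_ge0// subr_ge0.
  by case/andP: (rho01 (deg (edges x) v)).
Qed.

Lemma lyapunov_le : lyapunov x <= N%:R * L%:R
  + (4 * kap1 * (N%:R * L%:R) + 2 * L%:R ^+ 2)
  + beta * nu * (4 * kap2 * (N%:R * L%:R) + 2 * L%:R ^+ 2)
  + beta * L%:R * #|ones x|%:R.
Proof.
rewrite /lyapunov; apply: lerD; first apply: lerD; first apply: lerD.
- rewrite -natrM -cE -sum_deg// natr_sum; apply: ler_sum => v _.
  apply: (@le_trans _ _ (\sum_(j < deg (edges x) v) 1)).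
    by apply: ler_sum => j _; rewrite /high_degree; case: (_ <= _)%N; rewrite ?ler01.
  by rewrite sumr_const card_ord.
- exact: (fullness_le N_gt0 sE cE).
- rewrite ler_wpM2l ?mulr_ge0 ?(ltW nu_gt0) ?(ltW beta_gt0)//.
  exact: (fullness_le N_gt0 sE cE).
- rewrite ler_wpM2l ?mulr_ge0 ?(ltW beta_gt0)//.
  rewrite /ones -sum1_card natr_sum [leRHS]big_mkcond/=; apply: ler_sum => v _.
  rewrite inE; case: (state x v); rewrite ?mul1r ?mul0r//.
  by rewrite lerBlDr lerDl; case/andP: (rho01 (deg (edges x) v)).
Qed.

End Drift.

End Lyapunov.

(** * Failure probabilities *)

Section FailureProbability.
Variables (R : realType) (nu : R) (L N : nat).
Implicit Types (x y : config N) (v u r o z : 'I_N).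
Local Notation q := (nu / L%:R).
Local Notation step_mean := (step_mean nu L).

(** From [expR (- y) >= 1 - y]; what remains amounts to [0 <= y^2 (1 - 2 y)]. *)
Lemma expR_le_quadratic (y : R) : y <= 2^-1 -> expR y <= 1 + y + 2 * y ^+ 2.
Proof.
move=> y_le; have y1 : 0 < 1 - y by lra.
have : expR y <= (1 - y)^-1.
  rewrite -[expR y]invrK lef_pV2 ?posrE ?invr_gt0 ?expR_gt0//.
  by rewrite -expRN; have := expR_ge1Dx (- y).
move=> h; apply: (le_trans h); rewrite -[leLHS]mul1r ler_pdivrMr//.
have : 0 <= y ^+ 2 * (1 - 2 * y) by rewrite mulr_ge0 ?sqr_ge0//; lra.
by rewrite expr2 => h'; nra.
Qed.

Definition regular x : Prop :=
  simple_graph (edges x) /\ (2 * #|edges x| = N * L)%N.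

Lemma regular_rewire x r o z : regular x -> adjacent (edges x) r o ->
  z \in rewire_targets x r -> regular (rewire x r o z).
Proof.
case=> sE cE ro rz; split; first exact: (@simple_rewire _ x r o z).
by rewrite (card_rewire ro rz).
Qed.

Definition absorbed x : bool := discordant x == finset.set0.

Variables (V : config N -> R) (b c d lam : R).
Hypotheses (q01 : 0 <= q <= 1) (L_gt0 : (0 < L)%N) (nu_ge0 : 0 <= nu).
Hypotheses (V_ge0 : forall x, 0 <= V x) (b_ge0 : 0 <= b) (d_gt0 : 0 < d).

Definition balanced x : bool := `|#|ones x|%:R - c| < d.

Hypothesis V_rewire : forall x r o z, regular x -> adjacent (edges x) r o ->
  z \in rewire_targets x r -> `|V (rewire x r o z) - V x| <= b.
Hypothesis V_vote : forall x v u, regular x -> discordant_pair x v u ->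
  `|V (vote x v u) - V x| <= b * L%:R.
Hypothesis V_drift : forall x, regular x -> balanced x -> ~~ absorbed x ->
  step_mean (fun y => V y - V x) x <= - (5 / 16).
Hypothesis lam_ge0 : 0 <= lam.
Hypothesis lam_le : lam * ((b + 1) * L%:R) <= 2^-1.
Hypothesis lam_le2 : 2 * lam * ((b + 1) ^+ 2 * (1 + nu * L%:R)) <= 16^-1.

(** Second-order expansion of the exponential. A vote moves [V] by order [L] but has probability
    [nu / L], so the second moment is of order [L], which [lam] of order [1 / L] compensates. *)
Lemma step_mean_expR x : regular x -> balanced x -> ~~ absorbed x ->
  step_mean (fun y => expR (lam * (V y - V x + 4^-1))) x <= 1.
Proof.
move=> rx bx ax; have [sE _] := rx.
have L1 : 1 <= L%:R :> R by rewrite ler1n.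
pose k y : R := #|ones y|%:R.
(* The squared change of the number of ones is 1 after a vote and 0 after a rewiring: it acts as the
   indicator of a vote, with mean known from [step_mean_ones]. *)
pose g y := 1 + lam * (V y - V x + 4^-1)
  + 2 * lam ^+ 2 * (b + 1) ^+ 2 * (1 + L%:R ^+ 2 * (k y - k x) ^+ 2).
have bnd (w A D : R) : `|w| <= b * A -> 1 <= A -> A <= L%:R -> A ^+ 2 <= D ->
    expR (lam * (w + 4^-1)) <=
    1 + lam * (w + 4^-1) + 2 * lam ^+ 2 * (b + 1) ^+ 2 * D.
  move=> wA A1 AL AD.
  have w_le : `|w + 4^-1| <= (b + 1) * A.
    apply: (le_trans (ler_normD _ _)); rewrite (ger0_norm (_ : 0 <= 4^-1))//; lra.
  have b1 : 0 <= b + 1 by move: b_ge0 => ?; lra.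
  have lw : `|lam * (w + 4^-1)| <= 2^-1.
    rewrite normrM (ger0_norm lam_ge0); apply: le_trans lam_le.
    by rewrite ler_wpM2l//; apply: (le_trans w_le); rewrite ler_wpM2l.
  apply: (le_trans (expR_le_quadratic (le_trans (ler_norm _) lw))).
  rewrite lerD2l exprMn mulrA -[leRHS]mulrA ler_wpM2l ?mulr_ge0 ?sqr_ge0//.
  apply: (@le_trans _ _ (((b + 1) * A) ^+ 2)).
    by rewrite -real_normK ?num_real// lerXn2r ?nnegrE// mulr_ge0//; lra.
  by rewrite exprMn ler_wpM2l ?sqr_ge0.
have := @le_step_mean R nu L N x sE ax q01
  (fun y => expR (lam * (V y - V x + 4^-1))) g.
move=> H; apply: (le_trans (H _ _ _)) => {H}.
- move=> v u vu; apply: (bnd _ L%:R) => //; first exact: V_vote.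
  have -> : (k (vote x v u) - k x) ^+ 2 = 1.
    move: vu => /andP[_]; rewrite /k.
    case sv : (state x v); case su : (state x u) => // _.
      have /negbT su' := su.
      rewrite (ones_vote_loss sv su') -natr1 opprD addrA subrr sub0r.
      by rewrite sqrrN expr1n.
    have /negbT sv' := sv.
    by rewrite (ones_vote_gain sv' su) -natr1 addrAC subrr add0r expr1n.
  by rewrite mulr1 lerDr.
- move=> r o z /andP[ro _] rz; apply: (bnd _ 1) => //.
    by rewrite mulr1; apply: V_rewire.
  by rewrite expr1n /k subrr expr0n mulr0 addr0.
- rewrite /g subrr; apply: (bnd _ 1) => //.
    by rewrite normr0 mulr_ge0.
  by rewrite expr1n /k subrr expr0n mulr0 addr0.
have -> : step_mean g x =
    1 + lam * (step_mean (fun y => V y - V x) x + 4^-1)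
    + 2 * lam ^+ 2 * (b + 1) ^+ 2 * (1 + L%:R ^+ 2 * q).
  rewrite /g !step_meanD !step_meanZ !step_meanD !step_meanZ !step_mean_cst//.
  by rewrite step_mean_ones// subrr expr0n add0r.
have qL : L%:R ^+ 2 * q = nu * L%:R.
  by rewrite mulrCA; congr (_ * _); rewrite expr2 mulfK ?pnatr_eq0 -?lt0n.
rewrite qL.
(* The drift [- 5 / 16] and the time term [1 / 4] leave [- 1 / 16], which covers the quadratic term
   by [lam_le2]. *)
have h1 := V_drift rx bx ax.
have h2 := ler_wpM2l lam_ge0 lam_le2.
have h3 : lam * (step_mean (fun y => V y - V x) x + 4^-1) <= lam * - 16^-1.
  by rewrite ler_wpM2l//; lra.
move: h2; rewrite !expr2; move: (step_mean _ x) h3 => M h3 h2.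
have -> : 2 * (lam * lam) * ((b + 1) * (b + 1)) * (1 + nu * L%:R) =
  lam * (2 * lam * ((b + 1) * (b + 1) * (1 + nu * L%:R))) by ring.
lra.
Qed.

(** First-step recursion for the probability not to be absorbed within [k] updates while staying
    balanced up to and including absorption. *)
Fixpoint failure_prob k x : R :=
  if k is k'.+1 then
    if ~~ balanced x then 1 else
    if absorbed x then 0 else step_mean (failure_prob k') x
  else (~~ (balanced x && absorbed x))%:R.

(** Induction on [k]: the first term does not increase on average by [step_mean_expR], and the
    variance [q] per step balances the second. At an unbalanced configuration the second is at least
    1; at [k = 0] the first is at least 1 because [V] is nonnegative. *)
Lemma failure_prob_le k x : regular x ->
  failure_prob k x <= expR (lam * (V x - k%:R / 4))
    + ((#|ones x|%:R - c) ^+ 2 + q * k%:R) / d ^+ 2.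
Proof.
have d2 : 0 < d ^+ 2 by rewrite exprn_gt0.
have q0 : 0 <= q by case/andP: q01.
have err0 j y : 0 <= ((#|ones y|%:R - c) ^+ 2 + q * j%:R) / d ^+ 2.
  by rewrite divr_ge0 ?(ltW d2)// addr_ge0 ?sqr_ge0// mulr_ge0.
have unbal j y : ~~ balanced y -> 1 <= expR (lam * (V y - j%:R / 4))
    + ((#|ones y|%:R - c) ^+ 2 + q * j%:R) / d ^+ 2.
  rewrite /balanced -leNgt => dk; rewrite -[leLHS]add0r lerD ?expR_ge0//.
  rewrite ler_pdivlMr// mul1r -[leLHS]addr0 lerD ?mulr_ge0//.
  rewrite -[leRHS]real_normK ?num_real//.
  by rewrite lerXn2r// nnegrE ltW.
elim: k x => [|k IH] x rx /=.
  case: (boolP (balanced x)) => bx /=; last exact: unbal.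
  case: (boolP (absorbed x)) => _; first by rewrite addr_ge0 ?expR_ge0.
  rewrite -[leLHS]addr0 lerD// mul0r subr0 -expR0 ler_expR mulr_ge0//.
case: (boolP (balanced x)) => bx /=; last exact: unbal.
case: ifPn => ax; first by rewrite addr_ge0 ?expR_ge0.
have [sE _] := rx.
have := @le_step_mean R nu L N x sE ax q01 (failure_prob k)
  (fun y => expR (lam * (V x - k.+1%:R / 4)) *
              expR (lam * (V y - V x + 4^-1))
            + (d ^+ 2)^-1 * (#|ones y|%:R - c) ^+ 2 + q * k%:R / d ^+ 2).
(* Splits off the factor depending on [x] alone; one tick of the clock supplies the [4^-1] in the
   other. *)
have eqE y : expR (lam * (V y - k%:R / 4))
    + ((#|ones y|%:R - c) ^+ 2 + q * k%:R) / d ^+ 2 =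
  expR (lam * (V x - k.+1%:R / 4)) * expR (lam * (V y - V x + 4^-1))
  + (d ^+ 2)^-1 * (#|ones y|%:R - c) ^+ 2 + q * k%:R / d ^+ 2.
  rewrite -expRD -mulrDr mulrDl addrA (mulrC _ ((_ - c) ^+ 2)); congr (_ + _ + _).
  by congr (expR (_ * _)); rewrite -natr1; lra.
move=> H; apply: (le_trans (H _ _ _)) => {H}.
- by move=> v u vu; rewrite -eqE; apply: IH.
- by move=> r o z /andP[ro _] rz; rewrite -eqE; apply: IH; apply: regular_rewire.
- by rewrite -eqE; apply: IH.
rewrite !step_meanD !step_meanZ step_mean_cst// step_mean_ones//.
rewrite -addrA lerD//.
  by rewrite ler_piMr ?expR_ge0// step_mean_expR.
rewrite -natr1; move: (_ ^+ 2)^-1 => w; rewrite le_eqVlt; apply/orP; left.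
apply/eqP; move: ((_ - c) ^+ 2) q => e s; ring.
Qed.

End FailureProbability.

(** * From the recursion to trajectories of the chain *)

Section Paths.
Variables (R : realType) (nu : R) (L N : nat) (c d : R).
Variables (disp : measure_display) (T : measurableType disp).
Variables (P : probability T R) (G0 : config N) (X : nat -> T -> config N).
Hypothesis mcX : evolving_voter_model P nu L G0 X.

Local Notation balanced := (balanced c d (N := N)).
Local Notation failure_prob := (failure_prob nu L c d (N := N)).

Lemma measurable_state n (p : pred (config N)) :
  measurable [set t | p (X n t)]%classic.
Proof.
have -> : [set t | p (X n t)]%classic =
    (\big[setU/set0]_(s : config N | p s) [set t | X n t = s])%classic.
  rewrite -bigcup_seq_cond/=; apply/seteqP; split => [t pt|t [s /= ps e]].
    by exists (X n t) => //=; rewrite mem_index_enum.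
  by rewrite /= e; case/andP: ps.
by apply: bigsetU_measurable => s _; apply: mcX.1.
Qed.

Lemma measurable_prefix n (w : nat -> config N) :
  measurable [set t | forall i, (i <= n)%N -> X i t = w i]%classic.
Proof.
have -> : [set t | forall i, (i <= n)%N -> X i t = w i]%classic =
    (\bigcap_(i in [set i | (i <= n)%N]) [set t | X i t = w i])%classic.
  by apply/seteqP; split.
by apply: bigcap_measurable => [|i _]; [exists 0%N | apply: mcX.1].
Qed.

(** Pathwise counterpart of [failure_prob], read along a trajectory from time [n] on. *)
Fixpoint fails k n (x : nat -> config N) : bool :=
  if k is k'.+1 then
    ~~ balanced (x n) || (~~ absorbed (x n) && fails k' n.+1 x)
  else ~~ (balanced (x n) && absorbed (x n)).

Lemma measurable_fails k n : measurable [set t | fails k n (X ^~ t)]%classic.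
Proof.
elim: k n => [|k IH] n /=.
  exact: (measurable_state n (fun s => ~~ (balanced s && absorbed s))).
have -> : [set t | ~~ balanced (X n t) ||
    (~~ absorbed (X n t) && fails k n.+1 (X ^~ t))]%classic =
  ([set t | ~~ balanced (X n t)] `|`
   ([set t | ~~ absorbed (X n t)] `&` [set t | fails k n.+1 (X ^~ t)]))%classic.
  apply/seteqP; split => t /=.
    by case/orP => [?|/andP[? ?]]; [left|right].
  by case=> [->//|[-> ->]]; rewrite orbT.
apply: measurableU; first exact: (measurable_state n (fun s => ~~ balanced s)).
apply: measurableI => //; exact: (measurable_state n (fun s => ~~ absorbed s)).
Qed.

Lemma probability_bigsetU (I : Type) (r : seq I) (A : I -> set T) :
  (forall i, measurable (A i)) ->
  (P (\big[setU/set0]_(i <- r) A i)%classic <= \sum_(i <- r) P (A i))%E.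
Proof.
move=> mA; elim: r => [|i r IH]; first by rewrite !big_nil measure0.
rewrite !big_cons; apply: (le_trans (measureU2 _ _ _)) => //.
  by apply: bigsetU_measurable.
by rewrite leeD2l.
Qed.

Definition prefix_prob n (w : nat -> config N) : R :=
  (w 0%N == G0)%:R * \prod_(i < n) step_prob nu L (w i) (w i.+1).

(** Induction on [k], splitting by the state at time [n + 1]: the joint law of finite prefixes is
    all that the definition of the chain provides, and it suffices. *)
Lemma fails_prefix k n w :
  (P [set t | (forall i, (i <= n)%N -> X i t = w i) /\ fails k n (X ^~ t)]%classic
   <= (prefix_prob n w * failure_prob k (w n))%:E)%E.
Proof.
have mA j m (u : nat -> config N) : measurable
    [set t | (forall i, (i <= m)%N -> X i t = u i) /\ fails j m (X ^~ t)]%classic.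
  by apply: measurableI; [apply: measurable_prefix|apply: measurable_fails].
have P0 (A : set T) : A = set0 -> (P A <= 0%:E)%E by move=> ->; rewrite measure0.
(* [Ple] settles the cases where [failure_prob] is 1, and [Pempty] those where it is 0. *)
have Ple j : (P [set t | (forall i, (i <= n)%N -> X i t = w i)
    /\ fails j n (X ^~ t)]%classic <= (prefix_prob n w * 1)%:E)%E.
  rewrite mulr1 /prefix_prob -mcX.2; apply: le_measure; rewrite ?inE//.
    exact: measurable_prefix.
  by move=> t [].
have Pempty j : (forall t, X n t = w n -> fails j n (X ^~ t) -> False) ->
    (P [set t | (forall i, (i <= n)%N -> X i t = w i) /\
                fails j n (X ^~ t)]%classic <= 0%:E)%E.
  move=> h; rewrite (_ : [set t | _]%classic = classical_sets.set0) ?measure0//.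
  by apply/seteqP; split => t //= -[/(_ n (leqnn n))/h].
elim: k n w Ple Pempty => [|k IH] n w Ple Pempty.
  rewrite /=; case: (boolP (_ && _)) => [ba|_] /=; last exact: (Ple 0%N).
  rewrite mulr0; apply: (Pempty 0%N) => t /= ->; by rewrite ba.
rewrite [failure_prob _ _]/=; case: (boolP (balanced (w n))) => bw /=.
  case: (boolP (absorbed (w n))) => aw.
    by rewrite mulr0; apply: (Pempty k.+1) => t /= ->; rewrite bw aw.
  (* [u s] extends the prefix [w] by the state [s] at time [n + 1]. *)
  pose u s i := if (i <= n)%N then w i else s.
  have un s : u s n.+1 = s by rewrite /u ltnn.
  pose A s := [set t | (forall i, (i <= n.+1)%N -> X i t = u s i) /\
                       fails k n.+1 (X ^~ t)]%classic.
  apply: (@le_trans _ _ (P (\big[setU/set0]_(s : config N) A s)%classic)).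
    apply: le_measure; rewrite ?inE//.
    - exact: (mA k.+1).
    - by apply: bigsetU_measurable => s _; apply: mA.
    move=> t /= [wt]; rewrite wt// bw (negbTE aw) /= => ft.
    rewrite -bigcup_seq/=; exists (X n.+1 t); first by rewrite /= mem_index_enum.
    split=> // i; rewrite /u; case: (leqP i n) => [/wt//|ni] ni1.
    by have -> : i = n.+1 by apply/eqP; rewrite eqn_leq ni ni1.
  apply: (le_trans (probability_bigsetU _ _)) => [s|]; first exact: mA.
  rewrite /step_mean big_distrr/= -sumEFin; apply: lee_sum => s _.
  have IHs := IH n.+1 (u s); rewrite un in IHs.
  have -> : prefix_prob n w * (step_prob nu L (w n) s * failure_prob k s) =
      prefix_prob n.+1 (u s) * failure_prob k s.
    have u0 : u s 0%N = w 0%N by rewrite /u leq0n.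
    have un' : u s n = w n by rewrite /u leqnn.
    rewrite /prefix_prob big_ord_recr/= un un' u0 !mulrA.
    congr (_ * _ * _ * _); apply: eq_bigr => i _.
    by rewrite /u (ltn_ord i) (ltnW (ltn_ord i)).
  apply: IHs.
    move=> j; rewrite mulr1 /prefix_prob -mcX.2; apply: le_measure; rewrite ?inE//.
      exact: measurable_prefix.
    by move=> t [].
  move=> j h; rewrite (_ : [set t | _]%classic = classical_sets.set0) ?measure0//.
  apply/seteqP; split => t //= -[/(_ n.+1 (leqnn _)) xt ft].
  by apply: h ft; rewrite xt un.
exact: (Ple k.+1).
Qed.

(** The chain starts at [G0] only almost surely, so the null event of another start is added before
    [fails_prefix] is used. *)
Lemma fails_le k : (P [set t | fails k 0 (X ^~ t)]%classic
  <= (failure_prob k G0)%:E)%E.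
Proof.
have P1 : P [set t | X 0%N t = G0]%classic = 1%:E.
  transitivity (P [set t | forall i, (i <= 0)%N -> X i t = G0]%classic).
    congr (P _); apply/seteqP; split => t /= => [h [|i]//|h]; exact: h.
  by rewrite (mcX.2 0%N (fun=> G0)) eqxx big_ord0 mulr1.
have m0 : measurable [set t | X 0%N t = G0]%classic by apply: mcX.1.
have mf := measurable_fails k 0.
have PC : P (~` [set t | X 0%N t = G0])%classic = 0%E.
  by rewrite probability_setC// P1 subee.
pose F := [set t | (forall i, (i <= 0)%N -> X i t = G0) /\
                   fails k 0 (X ^~ t)]%classic.
have mF : measurable F by apply: measurableI; [exact: measurable_prefix|].
apply: (@le_trans _ _ (P (F `|` ~` [set t | X 0%N t = G0])%classic)).
  apply: le_measure; rewrite ?inE//.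
    by apply: measurableU => //; exact: measurableC.
  move=> t /= ft; case: (eqVneq (X 0%N t) G0) => [xt|/eqP xt]; last by right.
  by left; split=> // i; rewrite leqn0 => /eqP ->.
have PU : (P (F `|` ~` [set t | X 0%N t = G0])%classic <=
    P F + P (~` [set t | X 0%N t = G0])%classic)%E.
  exact: (measureU2 P mF (measurableC m0)).
apply: (le_trans PU); rewrite PC adde0; have := fails_prefix k 0 (fun=> G0).
by rewrite /prefix_prob eqxx big_ord0 !mul1r.
Qed.

(** The time [m] is the first absorption time from [n] on, so that [n = 0] gives [tau]. *)
Lemma not_fails k n x : ~~ fails k n x ->
  exists m, [/\ (n <= m <= n + k)%N, absorbed (x m), balanced (x m)
    & forall j, (n <= j < m)%N -> ~~ absorbed (x j)].
Proof.
elim: k n => [|k IH] n /=.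
  rewrite negbK => /andP[bn an]; exists n; split=> //.
    by rewrite addn0 leqnn.
  by move=> j; rewrite ltnNge andbN.
rewrite negb_or negbK negb_and negbK => /andP[bn].
case: (boolP (absorbed (x n))) => an /=.
  move=> _; exists n; split=> //; first by rewrite leqnn leq_addr.
  by move=> j; rewrite ltnNge andbN.
move=> /IH[m [/andP[nm mk] am bm h]]; exists m; split=> //.
  by rewrite (ltnW nm) -addSnnS.
move=> j /andP[]; rewrite leq_eqVlt => /orP[/eqP <-//|nj jm].
by apply: h; rewrite nj.
Qed.

End Paths.

(** * Asymptotics of the degree *)

Lemma near_powR_ge (R : realType) (b c : R) : 0 < b ->
  \forall N \near \oo%classic, c <= N%:R `^ b.
Proof.
move=> b0; have m0 : 0 <= Num.max c 1 by rewrite le_max ler01 orbT.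
near=> N; apply: (@le_trans _ _ (Num.max c 1)); first by rewrite le_max lexx.
have -> : Num.max c 1 = (Num.max c 1 `^ b^-1) `^ b.
  by rewrite -powRrM mulVf ?powRr1// lt0r_neq0.
apply: ge0_ler_powR; rewrite ?nnegrE ?powR_ge0 ?(ltW b0)//.
by near: N; apply: nbhs_infty_ger.
Unshelve. all: by end_near. Qed.

Section PowerDegree.
Variables (R : realType) (a : R) (L : nat -> nat).
Hypothesis a01 : 0 < a < 1.
Hypothesis L_equiv : ((fun N => (L N)%:R / (N%:R `^ a)) @ \oo --> (1 : R))%classic.

Lemma near_degree_bounds : \forall N \near \oo%classic,
  (N%:R : R) `^ a / 2 <= (L N)%:R <= 2 * N%:R `^ a.
Proof.
have /cvgrPdist_lt/(_ 2^-1) near_half := L_equiv.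
near=> N.
have N0 : (0 : R) < N%:R by rewrite ltr0n; near: N; apply: nbhs_infty_gt.
have Na0 : 0 < N%:R `^ a :> R by apply: powR_gt0.
have : `|1 - (L N)%:R / N%:R `^ a| < 2^-1 :> R.
  by near: N; apply: near_half; rewrite invr_gt0.
rewrite ltr_norml => /andP[h1 h2].
have -> : (L N)%:R = (L N)%:R / N%:R `^ a * N%:R `^ a :> R.
  by rewrite divfK// lt0r_neq0.
rewrite [_ / 2]mulrC !ler_pM2r//; lra.
Unshelve. all: by end_near. Qed.

Lemma near_degree_large (c : R) : \forall N \near \oo%classic, c <= (L N)%:R.
Proof.
have a0 : 0 < a by case/andP: a01.
near=> N; have /andP[h _] : (N%:R : R) `^ a / 2 <= (L N)%:R <= 2 * N%:R `^ a.
  by near: N; apply: near_degree_bounds.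
have : 2 * c <= N%:R `^ a by near: N; apply: near_powR_ge.
lra.
Unshelve. all: by end_near. Qed.

(** [L] is of order [N^a], and [N^(1 - a)] tends to infinity. *)
Lemma near_degree_sparse (c : R) : 0 <= c ->
  \forall N \near \oo%classic, c * (L N)%:R <= N%:R.
Proof.
move=> c0; have a1 : 0 < 1 - a by rewrite subr_gt0; case/andP: a01.
near=> N; have /andP[_ h] : (N%:R : R) `^ a / 2 <= (L N)%:R <= 2 * N%:R `^ a.
  by near: N; apply: near_degree_bounds.
have N0 : (0 : R) < N%:R by rewrite ltr0n; near: N; apply: nbhs_infty_gt.
have hN : 2 * c <= N%:R `^ (1 - a) by near: N; apply: near_powR_ge.
apply: (le_trans (ler_wpM2l c0 h)).
have NE : N%:R = N%:R `^ (1 - a) * N%:R `^ a :> R.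
  by rewrite -powRD ?subrK ?powRr1 ?(ltW N0)// lt0r_neq0 ?implybT.
by rewrite [leRHS]NE mulrA [c * 2]mulrC ler_wpM2r ?powR_ge0.
Unshelve. all: by end_near. Qed.

End PowerDegree.

(** * Choice of the constants *)

Section Constants.
Variables (R : realType) (nu : R).
Hypothesis nu_gt0 : 0 < nu.

(* With K = 512, a vertex of degree at most K L keeps the factor
   (1 - nu / L) ^ (K L) >= 1 / amplitude. *)
Definition amplitude : R := expR (2 * nu * 512).

(** The first bound controls the share of state 1 among the targets in the drift, the second the
    initial value of the last potential. *)
Definition minority_bound : R :=
  Num.min (64 * 32 * amplitude ^+ 2)^-1 (nu / (8 * amplitude)).

(** The first two terms come from rewirings; the last is [beta], from votes, whose increment is
    divided by [L]. *)
Definition increment_bound : R := 3 + 3 * amplitude + amplitude / nu.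

(** The exponent is [lambda = rate / L]; the 32 makes [2 * rate * (increment_bound + 1) ^+ 2 * (1 +
    nu)] equal to [1 / 16]. *)
Definition rate : R := (32 * (increment_bound + 1) ^+ 2 * (1 + nu))^-1.

Local Notation s := amplitude.

Lemma amplitude_ge1 : 1 <= s.
Proof.
rewrite -[leLHS]expR0 ler_expR; apply: mulr_ge0; last exact: ler0n.
by apply: mulr_ge0; [exact: ler0n|exact: ltW].
Qed.

Lemma amplitude_gt0 : 0 < s. Proof. exact: expR_gt0. Qed.

Lemma minority_bound_gt0 : 0 < minority_bound.
Proof.
have s0 := amplitude_gt0.
rewrite lt_min invr_gt0 mulr_gt0 ?exprn_gt0//=.
by rewrite divr_gt0// mulr_gt0.
Qed.

Lemma minority_bound_lt : minority_bound < 2^-1.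
Proof.
have s1 := amplitude_ge1; have s2 : 1 <= s ^+ 2 by rewrite exprn_ege1.
rewrite gt_min; apply/orP; left; rewrite ltf_pV2 ?posrE//; first by lra.
by apply: mulr_gt0 => //; lra.
Qed.

Lemma minority_bound_amplitude : minority_bound * (64 * 32 * s ^+ 2) <= 1.
Proof.
have s2 : 0 < 64 * 32 * s ^+ 2 by rewrite mulr_gt0// exprn_gt0// amplitude_gt0.
by rewrite -ler_pdivlMr// mul1r /minority_bound ge_min lexx.
Qed.

Lemma minority_bound_nu : minority_bound * (8 * (s / nu)) <= 1.
Proof.
have s2 : 0 < 8 * (s / nu) by rewrite mulr_gt0// divr_gt0// amplitude_gt0.
rewrite -ler_pdivlMr// mul1r /minority_bound ge_min mulrA invf_div lexx.
by rewrite orbT.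
Qed.

Lemma increment_bound_gt0 : 0 < increment_bound.
Proof.
have s0 := amplitude_gt0; have sn : 0 < s / nu by rewrite divr_gt0.
by rewrite /increment_bound; lra.
Qed.

Lemma rate_gt0 : 0 < rate.
Proof.
have b0 := increment_bound_gt0; rewrite invr_gt0; apply: mulr_gt0.
  by rewrite mulr_gt0// exprn_gt0//; lra.
by have := nu_gt0; lra.
Qed.

Lemma rate_inv : rate * (32 * (increment_bound + 1) ^+ 2 * (1 + nu)) = 1.
Proof. by have := rate_gt0; rewrite invr_gt0 => /lt0r_neq0/mulVf. Qed.

(** * Bounds on the potential with the chosen constants *)

Section Finite.
Variables (L N : nat).
Hypotheses (L_gt0 : (0 < L)%N) (nuL : 16 * nu <= L%:R :> R).
Hypothesis LN : 128 * 128 * s ^+ 2 * L%:R <= N%:R :> R.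
Local Notation q := (nu / L%:R).
Local Notation beta := (s / nu).
Local Notation kap2 := ((32 * s)^-1).
Local Notation potential :=
  (lyapunov nu L (N := N) 512 (16^-1 : R) kap2 beta).

Let LR : 0 < L%:R :> R. Proof. by rewrite ltr0n. Qed.

Let q_ge0 : 0 <= q. Proof. by rewrite divr_ge0 ?(ltW nu_gt0). Qed.

Let q_le : q <= 16^-1.
Proof. by have := nuL; rewrite ler_pdivrMr//; lra. Qed.

Let q_le2 : q <= 2^-1. Proof. by apply: le_trans q_le _; lra. Qed.

Let LsN : 128 * 128 * (s * L%:R) <= N%:R :> R.
Proof.
have s1 := amplitude_ge1; apply: le_trans LN.
rewrite -[leRHS]mulrA ler_wpM2l ?mulr_ge0 ?ler0n//.
by rewrite ler_wpM2r ?(ltW LR)// expr2 ler_peMl//; lra.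
Qed.

Let LN1 : 128 * 128 * L%:R <= N%:R :> R.
Proof.
apply: le_trans LsN; rewrite ler_wpM2l ?mulr_ge0 ?ler0n//.
rewrite ler_peMl ?(ltW LR)//.
exact: amplitude_ge1.
Qed.

Let N_gt0 : (0 < N)%N.
Proof. by rewrite -(ltr0n R); apply: lt_le_trans LN1; rewrite mulr_gt0. Qed.

Let NR : 0 < N%:R :> R. Proof. by rewrite ltr0n. Qed.

Let beta_gt0 : 0 < beta. Proof. by rewrite divr_gt0// amplitude_gt0. Qed.

Let bn : beta * nu = s. Proof. by rewrite divfK// lt0r_neq0. Qed.

Let kap2_gt0 : 0 < kap2.
Proof. by rewrite invr_gt0 mulr_gt0// amplitude_gt0. Qed.

Let kap2_le : kap2 <= 4^-1.
Proof.
have s1 := amplitude_ge1; rewrite lef_pV2 ?posrE//; first lra.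
by rewrite mulr_gt0// amplitude_gt0.
Qed.

Let kap1_gt0 : 0 < 16^-1 :> R. Proof. by rewrite invr_gt0. Qed.

Let kap1_le : 16^-1 <= 4^-1 :> R. Proof. by lra. Qed.

Let kap1N : 4 * L%:R <= 16^-1 * N%:R :> R.
Proof. by have := LN1; have := LR; lra. Qed.

Let kap2N : 4 * L%:R <= kap2 * N%:R :> R.
Proof.
rewrite [leRHS]mulrC ler_pdivlMr; last by rewrite mulr_gt0 ?amplitude_gt0.
have := LsN; have : 0 < s * L%:R by rewrite mulr_gt0 ?amplitude_gt0.
lra.
Qed.

(** As [q <= 1 / 2], [(1 - q) * expR (2 * q)] is at least 1; moreover [d * q] is at most
    [512 * nu]. *)
Let low_degree d : (d <= 512 * L)%N -> 1 <= beta * nu * (1 - q) ^+ d.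
Proof.
move=> dL; rewrite bn; have q0 := q_ge0; have q1 := q_le2.
have e1 : 1 <= (1 - q) * expR (2 * q).
  have e2 := expR_ge1Dx (2 * q).
  have r0 : 0 <= 1 - q by lra.
  apply: le_trans (ler_wpM2l r0 e2).
  have : 0 <= q * (1 - 2 * q) by rewrite mulr_ge0//; lra.
  by move: q => t; lra.
have : 1 <= ((1 - q) * expR (2 * q)) ^+ d by rewrite exprn_ege1.
move=> h; apply: (le_trans h); rewrite exprMn mulrC ler_wpM2r//.
  by rewrite exprn_ge0//; lra.
have dq : d%:R * q <= 512 * nu.
  rewrite mulrA ler_pdivrMr// mulrAC ler_wpM2r ?(ltW nu_gt0)//.
  by rewrite -natrM ler_nat.
rewrite -expRM_natl ler_expR mulrCA -[leRHS]mulrA ler_wpM2l// (mulrC nu 512).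
exact: dq.
Qed.

Lemma potential_ge0 (x : config N) : 0 <= potential x.
Proof. exact: lyapunov_ge0. Qed.

(** The lower bound is the upper bound for the reversed rewiring. *)
Lemma potential_rewire (x : config N) r o z : regular L x ->
  adjacent (edges x) r o -> z \in rewire_targets x r ->
  `|potential (rewire x r o z) - potential x| <= increment_bound.
Proof.
move=> rx ro rz; have b0 := ltW beta_gt0.
have up (y : config N) r' o' z' : regular L y -> adjacent (edges y) r' o' ->
    z' \in rewire_targets y r' ->
    potential (rewire y r' o' z') - potential y <= increment_bound.
  move=> [sE cE] ro' rz'; have := lyapunov_rewire_le 512 L_gt0 N_gt0 sE cE
    nu_gt0 q_le2 beta_gt0 kap1_gt0 kap1_le kap2_gt0 kap2_le kap1N kap2N ro' rz'.
  by rewrite bn /increment_bound => h; apply: (le_trans h); rewrite lerDl.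
rewrite ler_norml up// andbT lerNl opprB.
have rx' := regular_rewire rx ro rz.
have := up _ r z o rx' (adjacent_rewire_gained x r o z)
  (rewire_targets_lost rx.1 ro rz).
by rewrite (rewireK ro rz).
Qed.

Lemma potential_vote (x : config N) v u :
  `|potential (vote x v u) - potential x| <= increment_bound * L%:R.
Proof.
have b0 := ltW beta_gt0; have s0 := amplitude_gt0.
rewrite lyapunov_vote normrM (ger0_norm (mulr_ge0 b0 (ltW LR))).
apply: (@le_trans _ _ (beta * L%:R * 1)).
  apply: ler_wpM2l; first exact: mulr_ge0 b0 (ltW LR).
  rewrite normrM; apply: mulr_ile1; rewrite ?normr_ge0//.
    by case: (state x u); case: (state x v);
      rewrite ?subrr ?subr0 ?sub0r ?normrN ?normr0 ?normr1.
  have r01 : 0 <= 1 - q <= 1.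
    by have := q_ge0; have := q_le2; move: q => t; lra.
  have := exprn_ge0 (deg (edges x) v) (andP r01).1.
  have := exprn_ile1 (deg (edges x) v) (andP r01).1 (andP r01).2.
  move: (_ ^+ _) => t t1 t0; rewrite ler_norml; apply/andP; split; lra.
rewrite mulr1 ler_wpM2r ?(ltW LR)// /increment_bound.
by move: s0; move: s beta => a b; lra.
Qed.

(** The error budget: [1 / 32] from [q / 2], [1 / 16] from targets of high degree, [1 / 16] from
    targets in state 1, and less than [1 / 32] from all terms in [w = L / N]. The 2 in the
    hypothesis leaves room for the number of ones to move. *)
Lemma potential_drift (x : config N) : regular L x ->
  #|ones x|%:R <= 2 * minority_bound * N%:R :> R -> ~~ absorbed x ->
  step_mean nu L (fun y => potential y - potential x) x <= - (5 / 16).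
Proof.
move=> [sE cE] ones_le ax; have s1 := amplitude_ge1.
have N0 := NR; have L0 := LR.
have mb := minority_bound_amplitude.
have s2 : s <= s ^+ 2 by rewrite expr2 ler_peMl//; lra.
have mb0 := minority_bound_gt0.
have ones4 : (4 * #|ones x| <= N)%N.
  rewrite -(ler_nat R) natrM; have : minority_bound * 8 <= 1.
    by have := ler_wpM2l (ltW mb0) (_ : 8 <= 64 * 32 * s ^+ 2); lra.
  by move=> h; have := ler_wpM2r (ltW N0) h; lra.
have := lyapunov_drift L_gt0 N_gt0 (isT : 0 < 512)%N sE cE nu_gt0 q_le2 beta_gt0
  kap1_gt0 kap1_le kap2_gt0 kap2_le kap1N kap2N low_degree ones4 ax.
move=> h; apply: (le_trans h); rewrite /lyapunov_error bn.
have qb : q / 2 <= 32^-1 by have := q_le; lra.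
pose w := L%:R / N%:R : R.
have w0 : 0 <= w by rewrite divr_ge0.
have ws : 128 * 128 * s ^+ 2 * w <= 1.
  by rewrite /w mulrA ler_pdivrMr// mul1r; exact: LN.
have E1 : 2 / (512%:R * 16^-1) = 16^-1 :> R by lra.
have E2 : 8 * L%:R / (16^-1 * N%:R) = 128 * w :> R.
  by rewrite /w; field; rewrite lt0r_neq0.
have E3 : 8 * L%:R / (kap2 * N%:R) = 256 * s * w.
  by rewrite /w; field; rewrite !lt0r_neq0// amplitude_gt0.
have E4 : s * (2 * #|ones x|%:R / (kap2 * N%:R)) <= 16^-1.
  have -> : s * (2 * #|ones x|%:R / (kap2 * N%:R)) =
      64 * s ^+ 2 * (#|ones x|%:R / N%:R).
    by field; rewrite !lt0r_neq0// amplitude_gt0.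
  have on : #|ones x|%:R / N%:R <= 2 * minority_bound by rewrite ler_pdivrMr.
  have := ler_wpM2l (_ : 0 <= 64 * s ^+ 2) on.
  rewrite mulr_ge0 ?sqr_ge0// => /(_ isT) h'; apply: (le_trans h').
  by move: mb; move: (s ^+ 2) minority_bound => a b; nra.
have E5 : 8 * L%:R / N%:R = 8 * w by rewrite /w mulrA.
rewrite E1 E2 E3 E5.
have sw : s * w <= s ^+ 2 * w by rewrite ler_wpM2r.
have ssw : s * (256 * s * w) = 256 * (s ^+ 2 * w) by ring.
have w1 : w <= s ^+ 2 * w by rewrite ler_peMl//; lra.
rewrite ssw.
have ws' : 128 * 128 * (s ^+ 2 * w) <= 1 by rewrite mulrA.
have E6 : 8 * w * (3 / 2 + s) = 12 * w + 8 * (s * w) by field.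
rewrite E6; move: E4 sw w1 ws' qb.
move: (s * (2 * _ / _)) (s ^+ 2 * w) (q / 2) (s * w) => a b t e.
lra.
Qed.

(** In units of [N * L] the parts are at most 1, [1 / 4], [1 / 8] and [1 / 8], and the terms in
    [L ^+ 2] together at most [1 / 16]. *)
Lemma potential_initial (x : config N) : regular L x ->
  #|ones x|%:R <= minority_bound * N%:R :> R ->
  potential x <= 25 / 16 * (N%:R * L%:R).
Proof.
move=> [sE cE] ones_le; have s1 := amplitude_ge1; have N0 := NR; have L0 := LR.
have := lyapunov_le 512 N_gt0 sE cE nu_gt0 q_le2 beta_gt0 kap1_gt0 kap1_le
  kap2_gt0 kap2_le.
move=> h; apply: (le_trans h); rewrite bn.
have NL0 : 0 <= N%:R * L%:R :> R by rewrite mulr_ge0 ?ltW.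
have E1 : s * (4 * kap2 * (N%:R * L%:R)) = 8^-1 * (N%:R * L%:R).
  by field; rewrite lt0r_neq0// amplitude_gt0.
have E2 : beta * L%:R * #|ones x|%:R <= 8^-1 * (N%:R * L%:R).
  have b0 : 0 <= beta * L%:R by rewrite mulr_ge0 ?ltW.
  apply: (le_trans (ler_wpM2l b0 ones_le)).
  have := ler_wpM2r NL0 minority_bound_nu.
  rewrite mul1r; move: beta minority_bound => b m; lra.
have E3 : (2 + 2 * s) * L%:R ^+ 2 <= 16^-1 * (N%:R * L%:R).
  rewrite expr2 !mulrA ler_wpM2r//.
  have := LsN; have : L%:R <= s * L%:R by rewrite ler_peMl// ltW.
  have -> : (2 + 2 * s) * L%:R = 2 * L%:R + 2 * (s * L%:R) by ring.
  by move: (s * L%:R) => e; lra.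
have := E1; rewrite mulrDr => ->; move: E2 E3.
rewrite mulrDl; move: (beta * L%:R * _) (L%:R ^+ 2) NL0 => a b.
move: (N%:R * L%:R) => c; rewrite [s * (2 * b)]mulrCA -mulrA; lra.
Qed.

End Finite.
End Constants.

(** * Conclusion for large [N] *)

Lemma failure_prob_small (R : realType) (nu : R) (L N : nat) (G0 : config N)
    (p e : R) :
  0 < nu -> (0 < L)%N -> 16 * nu <= L%:R ->
  128 * 128 * amplitude nu ^+ 2 * L%:R <= N%:R ->
  0 <= p <= minority_bound nu -> 0 < e <= minority_bound nu ->
  regular L G0 -> #|ones G0|%:R = p * N%:R ->
  failure_prob nu L (p * N%:R) (e * N%:R) (7 * N * L).-1 G0 <=
  16 / (rate nu * N%:R) + 7 * nu / (e ^+ 2 * N%:R).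
Proof.
move=> nu0 L_gt0 nuL LN /andP[p0 p1] /andP[e0 e1] rG onesG.
have L0 : 0 < L%:R :> R by rewrite ltr0n.
have L1 : 1 <= L%:R :> R by rewrite ler1n.
have s1 := amplitude_ge1 nu0; have r0 := rate_gt0 nu0.
have b0 := increment_bound_gt0 nu0; have rinv := rate_inv nu0.
have N2 : 2 <= N%:R :> R.
  apply: le_trans LN; have s2 : 1 <= amplitude nu ^+ 2 by rewrite exprn_ege1.
  have : 1 <= amplitude nu ^+ 2 * L%:R by rewrite -[leLHS]mulr1 ler_pM.
  by rewrite -mulrA; move: (_ ^+ 2 * _) => t; lra.
have N0 : 0 < N%:R :> R by lra.
have N_gt0 : (0 < N)%N by rewrite -(ltr0n R).
have lam0 : 0 <= rate nu / L%:R by rewrite divr_ge0 ?ltW.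
set B := increment_bound nu + 1 in rinv.
have B1 : 1 <= B by rewrite /B lerDr ltW.
have rb : rate nu * (B ^+ 2 * (1 + nu)) = 32^-1.
  by move: rinv; rewrite !mulrA; move: (B ^+ 2) (rate nu) => a r; lra.
have q01 : 0 <= nu / L%:R <= 1.
  by rewrite divr_ge0 ?(ltW nu0)//= ler_pdivrMr// mul1r; lra.
have B2 : B <= B ^+ 2 * (1 + nu).
  apply: (@le_trans _ _ (B ^+ 2)); first by rewrite expr2 ler_peMl//; lra.
  by rewrite ler_peMr ?sqr_ge0//; lra.
have lam_le : rate nu / L%:R * (B * L%:R) <= 2^-1.
  rewrite mulrACA mulVf ?lt0r_neq0// mulr1.
  by have := ler_wpM2l (ltW r0) B2; lra.
have lam_le2 : 2 * (rate nu / L%:R) * (B ^+ 2 * (1 + nu * L%:R)) <= 16^-1.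
  have h : (1 + nu * L%:R) / L%:R <= 1 + nu.
    by rewrite ler_pdivrMr// mulrDl mul1r lerD2r.
  have := ler_wpM2l (_ : 0 <= rate nu * B ^+ 2) h.
  rewrite mulr_ge0 ?sqr_ge0 ?(ltW r0)// => /(_ isT).
  rewrite -(mulrA _ _ (1 + nu)) rb => h2.
  have -> : 2 * (rate nu / L%:R) * (B ^+ 2 * (1 + nu * L%:R)) =
    2 * (rate nu * B ^+ 2 * ((1 + nu * L%:R) / L%:R)) by field; rewrite lt0r_neq0.
  by move: (_ * (_ / _)) h2 => t h2; lra.
have := failure_prob_le q01 L_gt0 (ltW nu0)
  (potential_ge0 nu0 L_gt0 nuL (N := N)) (ltW b0) (mulr_gt0 e0 N0)
  (fun x r o z => @potential_rewire _ _ nu0 L N L_gt0 nuL LN x r o z)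
  (fun x v u _ _ => potential_vote nu0 L_gt0 nuL x v u) _ lam0 lam_le lam_le2
  (7 * N * L).-1 rG.
move=> h; apply: le_trans (h (p * N%:R) _) _ => {h}.
  (* Both [p] and [e] are at most [minority_bound nu], so a balanced configuration has at most
     [2 * minority_bound nu * N] ones. *)
  move=> x rx; rewrite /balanced ltr_norml => /andP[_ bal] ax.
  apply: potential_drift => //; rewrite -mulrA.
  have := ler_wpM2r (ltW N0) p1; have := ler_wpM2r (ltW N0) e1.
  move: bal; move: (minority_bound nu * _) (p * _) (e * _) (#|ones x|%:R) => t a b k.
  lra.
(* The horizon is [7 N L - 1] because [tau] has to be strictly below [7 N L]. *)
have T_le : ((7 * N * L).-1)%:R = 7 * N%:R * L%:R - 1 :> R.
  have T0 : (0 < 7 * N * L)%N 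
    by rewrite !muln_gt0 L_gt0 N_gt0.
  by rewrite -!natrM -[in RHS](prednK T0) -natr1 addrK.
have NL : 2 <= N%:R * L%:R :> R by rewrite -[leLHS]mulr1 ler_pM.
apply: lerD.
  have V_le : lyapunov nu L 512 16^-1 (32 * amplitude nu)^-1 (amplitude nu / nu) G0
      <= 25 / 16 * (N%:R * L%:R).
    apply: potential_initial => //; rewrite onesG ler_wpM2r// ltW.
  set z := rate nu * N%:R / 16.
  have z0 : 0 < z by rewrite divr_gt0// mulr_gt0.
  apply: (@le_trans _ _ (expR (- z))).
    rewrite ler_expR T_le /z; set V := lyapunov _ _ _ _ _ _ _ in V_le *.
    (* Per unit of [N L], [25 / 16 - 7 / 4 = - 3 / 16]; the [1 / 4] lost to the shortened horizon is
       covered by [2 <= N L]. *)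
    have h : V - (7 * N%:R * L%:R - 1) / 4 <= - (N%:R * L%:R) / 16.
      by move: V_le NL; rewrite -(mulrA 7); move: (N%:R * L%:R) V => a b; lra.
    apply: (le_trans (ler_wpM2l lam0 h)); rewrite le_eqVlt; apply/orP; left.
    by apply/eqP; field; rewrite lt0r_neq0.
  rewrite expRN -[16 / _]invf_div lef_pV2 ?posrE ?expR_gt0//.
  by apply: le_trans (expR_ge1Dx z) => //; rewrite lerDr.
rewrite onesG subrr expr0n add0r T_le /=.
rewrite ler_pdivrMr ?exprn_gt0 ?mulr_gt0//.
have -> : 7 * nu / (e ^+ 2 * N%:R) * (e * N%:R) ^+ 2 = 7 * N%:R * nu.
  by field; rewrite !lt0r_neq0.
apply: (@le_trans _ _ (nu / L%:R * (7 * N%:R * L%:R))).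
  by rewrite ler_wpM2l ?(andP q01).1// lerBlDr lerDl.
rewrite le_eqVlt; apply/orP; left; apply/eqP; field.
by rewrite lt0r_neq0.
Qed.

Lemma measurable_tau (R : realType) (nu : R) (L N : nat)
    (d : measure_display) (T : measurableType d) (P : probability T R)
    (G0 : config N) (X : nat -> T -> config N) (k : nat) (p : pred (config N)) :
  evolving_voter_model P nu L G0 X ->
  measurable [set t | exists n, [/\ is_tau (X ^~ t) n, (n < k)%N
                                  & p (X n t)]]%classic.
Proof.
move=> mcX; pose A n :=
  ([set t | absorbed (X n t) && p (X n t)] `&`
   \bigcap_(m in `I_n) [set t | ~~ absorbed (X m t)])%classic.
have -> : [set t | exists n, [/\ is_tau (X ^~ t) n, (n < k)%N
                               & p (X n t)]]%classic =
          (\bigcup_(n in `I_k) A n)%classic.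
  apply/seteqP; split => [t /= [n [[/eqP an am] nk pn]]|t [n nk]].
    exists n => //; split; first by rewrite /= /absorbed an.
    by move=> m /am/eqP.
  move=> [/andP[/eqP an pn] am]; exists n; split=> //; split=> // m /am.
  by move=> /= /eqP.
apply: bigcup_measurable => n _; apply: measurableI.
  exact: (measurable_state mcX n (fun s => absorbed s && p s)).
(* At [n = 0] the index set is empty, while [bigcap_measurable] asks for a nonempty one. *)
case: n => [|n]; first by rewrite II0 bigcap_set0.
apply: bigcap_measurable => [|m _]; first by exists 0%N.
exact: (measurable_state mcX m (fun s => ~~ absorbed s)).
Qed.

Lemma near_Lyapunov_regime (R : realType) (nu a c : R) (L : nat -> nat) :
  0 < nu -> 0 < a < 1 ->
  ((fun N => (L N)%:R / (N%:R `^ a)) @ \oo --> (1 : R))%classic ->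
  \forall N \near \oo%classic, [/\ 16 * nu <= (L N)%:R,
    128 * 128 * amplitude nu ^+ 2 * (L N)%:R <= N%:R & c <= N%:R].
Proof.
move=> nu0 a01 HL; near=> N; split; near: N.
- exact: near_degree_large a01 HL _.
- by apply: (near_degree_sparse a01 HL); rewrite mulr_ge0 ?sqr_ge0.
- exact: nbhs_infty_ger.
Unshelve. all: by end_near. Qed.

Local Open Scope classical_set_scope.

Theorem theorem6 (R : realType) (nu : R) (nu_gt0 : 0 < nu) :
  exists pnu : R, 0 < pnu < 2^-1 /\
  forall (a : R) (L : nat -> nat) (eps p : R),
    0 < a < 1 ->
    (forall N, (0 < L N)%N) ->
    (forall N, ~~ odd (N * L N)) ->
    (fun N => (L N)%:R / (N%:R `^ a)) @ \oo --> (1 : R) ->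
    0 < eps ->
    0 <= p <= pnu ->
    forall delta : R, 0 < delta ->
    \forall N \near \oo,
      forall G0 : config N, initial_config p (L N) G0 ->
      forall (d : measure_display) (T : measurableType d)
             (P : probability T R) (X : nat -> T -> config N),
        evolving_voter_model P nu (L N) G0 X ->
        ((1 - delta)%:E <=
          P [set t | exists n, [/\ is_tau (X ^~ t) n,
                       (n < 7 * N * L N)%N
                     & (p - eps < fraction_ones R (X n t) < p + eps)%R]])%E.
Proof.
exists (minority_bound nu).
split; first by rewrite minority_bound_gt0// minority_bound_lt.
move=> a L eps p a01 L_gt0 L_even L_lim eps0 p01 delta delta0.
have r0 := rate_gt0 nu_gt0; have mb0 := minority_bound_gt0 nu_gt0.
(* Capping [eps] keeps the balanced configurations in the range where the drift estimate holds. *)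
pose e := Num.min eps (minority_bound nu).
have e0 : 0 < e by rewrite lt_min eps0.
have e_eps : e <= eps by rewrite ge_min lexx.
have e_mb : e <= minority_bound nu by rewrite ge_min lexx orbT.
(* From [N >= c] on, the failure bound is at most [delta]; the added 1 makes [N] positive. *)
pose c := (16 / rate nu + 7 * nu / e ^+ 2) / delta + 1.
have c1_ge0 : 0 <= 16 / rate nu + 7 * nu / e ^+ 2.
  apply: addr_ge0; first by rewrite divr_ge0 ?(ltW r0).
  by rewrite divr_ge0 ?sqr_ge0// mulr_ge0// ltW.
(* The threshold on [N] is fixed before [G0] and the probability space, which gives the
   uniformity. *)
have := near_Lyapunov_regime c nu_gt0 a01 L_lim.
apply: filterS => N [nuL LN cN] G0 [sE onesG cE] d T P X mcX.
have N0 : 0 < N%:R :> R.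
  apply: lt_le_trans cN; rewrite /c ltr_wpDl// divr_ge0// ltW//.
have N_gt0 : (0 < N)%N by rewrite -(ltr0n R).
have rG : regular (L N) G0.
  split=> //; rewrite cE mul2n -[RHS]odd_double_half.
  by rewrite (negbTE (L_even N)).
have small : failure_prob nu (L N) (p * N%:R) (e * N%:R)
    (7 * N * L N).-1 G0 <= delta.
  have e01 : 0 < e <= minority_bound nu by rewrite e0.
  apply: (le_trans (failure_prob_small nu_gt0 (L_gt0 N) nuL LN p01 e01 rG onesG)).
  have -> : 16 / (rate nu * N%:R) + 7 * nu / (e ^+ 2 * N%:R) =
      (16 / rate nu + 7 * nu / e ^+ 2) / N%:R by field; rewrite !lt0r_neq0.
  rewrite ler_pdivrMr// [leRHS]mulrC -ler_pdivrMr//.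
  by apply: le_trans cN; rewrite lerDl.
set F := [set t | fails (p * N%:R) (e * N%:R) (7 * N * L N).-1 0 (X ^~ t)].
have mF : measurable F by exact: measurable_fails mcX _ _.
have PF : (P F <= delta%:E)%E.
  by apply: (le_trans (fails_le _ _ mcX _)); rewrite lee_fin.
apply: (@le_trans _ _ (P (~` F))).
  by rewrite probability_setC// EFinB leeB.
apply: le_measure; rewrite ?inE; first exact: measurableC.
  exact: (measurable_tau _
    (fun x => p - eps < fraction_ones R x < p + eps) mcX).
(* Outside [F] the first absorption time [m] is below [7 N L] with [X m] balanced; dividing by [N]
   and using [e <= eps] gives the interval. *)
move=> t /= /negP/not_fails[m [/andP[_ mT] am bm hm]]; exists m; split.
- by split; [exact/eqP|move=> j jm; apply/eqP/hm].
- rewrite -(@prednK (7 * N * L N)) ?ltnS//.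
  by rewrite !muln_gt0 L_gt0 N_gt0.
move: bm; rewrite /balanced /fraction_ones ltr_norml => /andP[h1 h2].
rewrite ltr_pdivlMr// ltr_pdivrMr//.
have := ler_wpM2r (ltW N0) e_eps => h3.
by apply/andP; split; lra.
Qed.
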